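(* Let $\Omega$ be an open bounded connected subset of $\mathbb{R}^2$ with Lipschitz boundary. Then there exists a constant $C>0$ such that $$P_H^2(E;\Omega)\ \ge\ C\,\min\{|E|,\ |\Omega\setminus E|\}$$ for every measurable set $E\subseteq\Omega$, where $P_H^2(E;\Omega)=(P_H(E;\Omega))^2$.
   Context: Standing assumptions on $H$: $H:\mathbb{R}^2\to[0,+\infty)$ is of class $C^2(\mathbb{R}^2\setminus\{0\})$, $H^2$ is strictly convex, $H(t\xi)=|t|H(\xi)$ for all $\xi\in\mathbb{R}^2$, $t\in\mathbb{R}$, and there are constants $0<\alpha\le\beta$ with $\alpha|\xi|\le H(\xi)\le\beta|\xi|$ for all $\xi\in\mathbb{R}^2$. The polar function of $H$ is $H^o(v)=\sup_{\xi\neq0}\frac{\langle\xi,v\rangle}{H(\xi)}$. For $\Omega$ open and bounded and $F\subset\mathbb{R}^2$ measurable, the anisotropic perimeter of $F$ in $\Omega$ is $$P_H(F;\Omega)=\sup\Big\{\int_F \operatorname{div}\sigma\,dx:\ \sigma\in C_0^1(\Omega;\mathbb{R}^2),\ H^o(\sigma)\le1\Big\}\in[0,+\infty].$$ $|E|$ denotes Lebesgue measure. *)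

(* Defs.v *)
From HB Require Import structures.
From mathcomp Require Import all_boot all_order all_algebra.
From mathcomp Require Import all_classical all_reals all_analysis.

Set Implicit Arguments.
Unset Strict Implicit.
Unset Printing Implicit Defensive.

Import Order.TTheory GRing.Theory Num.Theory.
Import numFieldNormedType.Exports.

Local Open Scope classical_set_scope.
Local Open Scope ring_scope.

Section Plane.
Context {R : realType}.
Implicit Types (x y v : R * R) (A : set (R * R)).

Definition dot x y : R := x.1 * y.1 + x.2 * y.2.

(* The library norm on [R * R] is the max norm, hence this definition. *)
Definition enorm x : R := Num.sqrt (dot x x).

Definition e1 : R * R := (1, 0).
Definition e2 : R * R := (0, 1).

(* [f] is of class C^k on [A], which is meant to be open. *)
Fixpoint class_C (k : nat) A (f : R * R -> R) : Prop :=
  match k with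
  | 0 => forall x, A x -> {for x, continuous f}
  | k'.+1 =>
      [/\ forall x, A x -> derivable f x e1 /\ derivable f x e2,
          class_C k' A ('D_e1 f) & class_C k' A ('D_e2 f)]
  end.

Definition strictly_convex (f : R * R -> R) : Prop :=
  forall x y (t : R), x != y -> 0 < t < 1 ->
    f (t *: x + (1 - t) *: y) < t * f x + (1 - t) * f y.

Definition borel_lebesgue2 :
    {measure set (measurableTypeR R * measurableTypeR R) -> \bar R} :=
  (@lebesgue_measure R \x @lebesgue_measure R)%E.

(* Lebesgue measure on the plane, on the sigma-algebra of all Lebesgue
   measurable sets (Caratheodory measurable for the outer measure), whereas the
   library's product measure lives on the Borel sigma-algebra. *)
Definition lebesgue2 :=
  @completed_measure_extension _ _ _ borel_lebesgue2.
HB.instance Definition _ := Measure.on lebesgue2.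

Definition lebesgue2_measurable A : Prop :=
  (borel_lebesgue2^*)%mu.-cara.-measurable A.

Definition polar (H : R * R -> R) v : R :=
  sup [set dot x v / H x | x in [set x | x != 0]].

Definition divergence (s : R * R -> R * R) x : R :=
  'D_e1 (fst \o s) x + 'D_e2 (snd \o s) x.

Definition supp (s : R * R -> R * R) := closure [set x | s x != 0].

(* Fields defined on [A] are identified with their extension by zero. *)
Definition C1_0 A (s : R * R -> R * R) : Prop :=
  [/\ class_C 1 setT (fst \o s), class_C 1 setT (snd \o s),
      compact (supp s) & supp s `<=` A].

Definition perimeter (H : R * R -> R) A F : \bar R :=
  ereal_sup [set (\int[lebesgue2]_(x in F) (divergence s x)%:E)%E
            | s in [set s | C1_0 A s /\ forall x, polar H (s x) <= 1]].

(* Near each boundary point, in the orthonormal frame obtained by rotating the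
   standard one so that its first vector is [u], [A] is the strict epigraph of
   a Lipschitz function. *)
Definition lipschitz_boundary A : Prop :=
  forall p, (closure A `\` A°) p ->
  exists (r : R) (u : R * R) (g : R -> R),
    [/\ 0 < r, enorm u = 1, lipschitz g &
     forall x, enorm (x - p) < r ->
       A x <-> g (dot x u) < dot x (- u.2, u.1)].

End Plane.

(* Main.v *)
Require Import Defs.
From HB Require Import structures.
From mathcomp Require Import all_boot all_order all_algebra.
From mathcomp Require Import all_classical all_reals all_analysis.
From mathcomp Require Import measurable_realfun ring lra.

(** A relative isoperimetric inequality holds because a set of small perimeter
    is constant along most lines.

    The function [H] enters through [alpha * enorm x <= H x], which makes
    every C^1 field with compact support in [Omega] and Euclidean norm at most
    [alpha] a competitor in the definition of the perimeter ([polar_le1]).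

    The domain is first cut into charts.  In a suitable affine frame around a
    point of the closure of [Omega], the part of [Omega] in the unit square is
    closed under moving right and up, and contains everything to the right of
    1/2 and everything above 1/2 ([boundary_chart] uses the cone condition of a
    Lipschitz boundary; interior points are trivial).

    In a chart, let [F] be the set of perimeter at most [P].  Test fields along
    the first coordinate are sums of blocks over disjoint intervals of heights;
    their size does not grow with the number of blocks, so their total action on
    [F] is at most a multiple of [P].  Almost every height at which the slice of [F] is
    neither null nor full carries, by Lebesgue's density and differentiation
    theorems, a block with an action proportional to its radius.  A Vitali
    covering then shows that these heights form a set of measure at most a
    multiple of [P] ([slice_constant], [jump_set_le]).  The same holds for
    vertical lines.  If both exceptional sets [N1] and [N2] have measure less
    than 1/2, the remaining lines cross one another, so almost all of them are
    null for [F], or almost all are full, and [F] or its complement lies, up to a null set, in the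
    rectangle [N2 `*` N1], whose measure is at most a multiple of [P ^+ 2]
    ([crossing], [chart_isoperimetric]).

    Finitely many charts cover [Omega].  When [P] is small the side that is
    small must be the same for overlapping charts, and connectedness makes it
    the same for all ([global_isoperimetric]); when [P] is not small the finite
    measure of [Omega] is enough.

    The argument is carried out for Borel sets.  A Lebesgue measurable set
    differs from a Borel set containing it by a null set ([borel_envelope]), a
    change that affects neither the measures nor the perimeter. *)

Set Implicit Arguments.
Unset Strict Implicit.
Unset Printing Implicit Defensive.

Import Order.TTheory GRing.Theory Num.Theory.
Import numFieldNormedType.Exports.

Local Open Scope classical_set_scope.
Local Open Scope ring_scope.

(** * A smooth step and a smooth bump on the line *)

Section profiles.
Context {R : realType}.
Implicit Types x h : R.

Definition pos x : R := Num.max 0 x.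

Lemma posP x : (0 <= x /\ pos x = x) \/ (x <= 0 /\ pos x = 0).
Proof.
rewrite /pos; case: (lerP 0 x) => hx; [left|right]; split=> //; exact: ltW.
Qed.

(** The square of the positive part is the building block of all profiles:
    it is C^1 with a quadratic Taylor remainder, which is what
    [is_derive_taylor] asks for, and it vanishes on a half-line. *)
Lemma pos_sqr_taylor x h :
  `|pos (h + x) ^+ 2 - pos x ^+ 2 - h * (2 * pos x)| <= h ^+ 2.
Proof.
rewrite ler_norml; apply/andP; split;
by case: (posP x) => -[? ->]; case: (posP (h + x)) => -[? ->]; nra.
Qed.

Lemma continuous_pos : continuous pos.
Proof. by move=> x; apply: continuous_max => //; exact: cst_continuous. Qed.

Lemma is_derive_taylor (f : R -> R) (d K x : R) :
  (forall h, `|f (h + x) - f x - h * d| <= K * h ^+ 2) -> is_derive x 1 f d.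
Proof.
move=> hf.
have cf : (fun h => h^-1 *: (f (h *: 1 + x) - f x)) @ 0^' --> d.
  apply/cvgrPdist_le => e e0.
  have e1 : 0 < e / (`|K| + 1) by rewrite divr_gt0// ltr_wpDl.
  near=> h.
  have h0 : h != 0 by near: h; exact: nbhs_dnbhs_neq.
  have hs : `|h| <= e / (`|K| + 1) by near: h; exact: dnbhs0_le.
  rewrite [h *: 1]mulr1 distrC -(ler_pM2l (_ : 0 < `|h|)) ?normr_gt0//.
  rewrite -normrM mulrBr [_ *: _]/(_ * _) mulrA divff// mul1r.
  apply: (le_trans (hf h)); rewrite -real_normK ?num_real// expr2.
  rewrite mulrCA ler_pM2l ?normr_gt0//.
  apply: (@le_trans _ _ ((`|K| + 1) * `|h|)).
    by rewrite ler_wpM2r// (le_trans (ler_norm _))// lerDl.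
  by rewrite mulrC -ler_pdivlMr// ltr_wpDl.
split.
  by apply/cvg_ex; exists d; exact: cf.
by apply: cvg_lim => //; exact: cf.
Unshelve. all: by end_near. Qed.

(** The second difference of the squared positive part: a C^1 function that
    climbs from 0 to 1 on the interval from -1 to 1.  Its derivative [tent] is
    the second difference of the positive part, the hat function of integral 1. *)
Definition step x : R :=
  (pos (x + 1) ^+ 2 - 2 * pos x ^+ 2 + pos (x - 1) ^+ 2) / 2.
Definition tent x : R := pos (x + 1) - 2 * pos x + pos (x - 1).

Lemma is_derive_step x : is_derive x 1 step (tent x).
Proof.
apply: (@is_derive_taylor _ _ 2) => h.
have := pos_sqr_taylor (x + 1) h; have := pos_sqr_taylor x h.
have := pos_sqr_taylor (x - 1) h; rewrite /step /tent !addrA.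
rewrite !ler_norml => /andP[? ?] /andP[? ?] /andP[? ?].
apply/andP; split; lra.
Qed.

Lemma continuous_tent : continuous tent.
Proof.
move=> x; rewrite /tent; apply: cvgD; first apply: cvgB.
- by apply: continuous_cvg; [exact: continuous_pos|
    apply: cvgD; [exact: cvg_id|exact: cvg_cst]].
- by apply: cvgM; [exact: cvg_cst|exact: continuous_pos].
- by apply: continuous_cvg; [exact: continuous_pos|
    apply: cvgB; [exact: cvg_id|exact: cvg_cst]].
Qed.

Ltac pos_cases x :=
  case: (posP x) => -[? ->]; case: (posP (x + 1)) => -[? ->];
  case: (posP (x - 1)) => -[? ->].

Lemma step_ge0 x : 0 <= step x.
Proof. rewrite /step; pos_cases x; nra. Qed.
Lemma step_le1 x : step x <= 1.
Proof. rewrite /step; pos_cases x; nra. Qed.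
Lemma step_left x : x <= -1 -> step x = 0.
Proof. move=> ?; rewrite /step; pos_cases x; try lra; nra. Qed.
Lemma step_right x : 1 <= x -> step x = 1.
Proof. move=> ?; rewrite /step; pos_cases x; try lra; nra. Qed.
Lemma tent_ge0 x : 0 <= tent x.
Proof. rewrite /tent; pos_cases x; lra. Qed.
Lemma tent_le1 x : tent x <= 1.
Proof. rewrite /tent; pos_cases x; lra. Qed.
Lemma tent_out x : 1 <= `|x| -> tent x = 0.
Proof.
by rewrite ler_normr => /orP[] ?; rewrite /tent; pos_cases x; lra.
Qed.
Lemma tent_in x : `|x| <= 2^-1 -> 2^-1 <= tent x.
Proof.
by rewrite ler_norml => /andP[? ?]; rewrite /tent; pos_cases x; lra.
Qed.

(** The product [(1 + x)^2 (1 - x)^2] cut off outside the interval from -1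
    to 1, where it already vanishes to second order, so that it stays C^1. *)
Definition bell x : R := pos (1 + x) ^+ 2 * pos (1 - x) ^+ 2.
Definition dbell x : R :=
  pos (1 + x) ^+ 2 * - (2 * pos (1 - x)) +
  pos (1 - x) ^+ 2 * (2 * pos (1 + x)).

Lemma is_derive_bell x : is_derive x 1 bell (dbell x).
Proof.
rewrite /bell /dbell.
have d1 : is_derive x 1 (fun x => pos (1 + x) ^+ 2) (2 * pos (1 + x)).
  apply: (@is_derive_taylor _ _ 1) => h.
  by rewrite mul1r addrCA; exact: pos_sqr_taylor.
have d2 : is_derive x 1 (fun x => pos (1 - x) ^+ 2) (- (2 * pos (1 - x))).
  apply: (@is_derive_taylor _ _ 1) => h.
  have := pos_sqr_taylor (1 - x) (- h).
  by rewrite mul1r sqrrN mulrN mulNr opprD addrCA.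
exact: (is_deriveM d1 d2).
Qed.

Lemma continuous_dbell : continuous dbell.
Proof.
move=> x.
have c1 : pos (1 + y) @[y --> x] --> pos (1 + x).
  by apply: continuous_cvg; [exact: continuous_pos|
    apply: cvgD; [exact: cvg_cst|exact: cvg_id]].
have c2 : pos (1 - y) @[y --> x] --> pos (1 - x).
  by apply: continuous_cvg; [exact: continuous_pos|
    apply: cvgB; [exact: cvg_cst|exact: cvg_id]].
by rewrite /dbell; apply: cvgD; apply: cvgM; rewrite ?expr2;
  do ?[exact: cvg_cst|exact: c1|exact: c2|apply: cvgM|apply: cvgN].
Qed.

Lemma bell_ge0 x : 0 <= bell x.
Proof. by rewrite /bell mulr_ge0// sqr_ge0. Qed.
Lemma bell_out x : 1 <= `|x| -> bell x = 0.
Proof.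
have pos0 y : y <= 0 -> pos y = 0 by move=> ?; case: (posP y) => -[? ->] //; lra.
rewrite ler_normr /bell => /orP[] ?.
  by rewrite (pos0 (1 - x)) ?expr0n ?mulr0//; lra.
by rewrite (pos0 (1 + x)) ?expr0n ?mul0r//; lra.
Qed.
Lemma bell_le1 x : bell x <= 1.
Proof.
rewrite /bell; case: (posP (1 + x)) => -[? ->];
case: (posP (1 - x)) => -[? ->]; rewrite ?expr0n ?mul0r ?mulr0//.
rewrite -exprMn expr_le1//; last by apply: mulr_ge0.
nra.
Qed.
Lemma bell_in x : `|x| <= 2^-1 -> 2^-1 <= bell x.
Proof.
rewrite ler_norml => /andP[? ?]; rewrite /bell.
case: (posP (1 + x)) => -[? ->]; case: (posP (1 - x)) => -[? ->]; try lra.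
rewrite -exprMn (_ : (1 + x) * (1 - x) = 1 - x ^+ 2); last by ring.
have : x ^+ 2 <= 4^-1 by nra.
set y := x ^+ 2 => ?; nra.
Qed.

End profiles.

Section affine_composition.
Context {R : realType}.
Implicit Types (f : R -> R) (L : R * R -> R) (x v : R * R).

(** A function of one affine coordinate [L] has a directional derivative
    determined by the slope [l] of [L] in that direction.  Test functions are
    products of functions of single coordinates, so no general chain rule in the
    plane is needed. *)
Lemma is_derive_affine f L x v l d :
  (forall h, L (h *: v + x) = h * l + L x) ->
  is_derive (L x) 1 f d -> is_derive x v (f \o L) (l * d).
Proof.
move=> hL [fd fE].
have fd' := (derivable1_diffP _ _).1 fd.
have dl : derivable f (L x) l by exact: diff_derivable.
have fl : 'D_l f (L x) = l * d.
  rewrite deriveE// -[l in LHS]mulr1 [l * 1]/(l *: 1) linearZ/= -deriveE//.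
  by rewrite fE.
have E : (fun h => h^-1 *: ((f \o L) (h *: v + x) - (f \o L) x)) =
         (fun h => h^-1 *: (f (h *: l + L x) - f (L x))).
  by apply/funext => h /=; rewrite hL.
split; first by rewrite /derivable E.
by rewrite /derive E.
Qed.

End affine_composition.

(** * Affine frames *)

Section charts.
Context {R : realType}.
Implicit Types (p v w x y e : R * R).

Definition det2 v w : R := v.1 * w.2 - v.2 * w.1.

(** The affine coordinates with origin [p] and basis vectors [v], [w];
    [coord] is the inverse map, given by Cramer's rule. *)
Definition frame p v w y : R * R := p + y.1 *: v + y.2 *: w.

Definition coord p v w x : R * R :=
  (det2 (x - p) w / det2 v w, det2 v (x - p) / det2 v w).

Lemma frameK p v w : det2 v w != 0 -> cancel (frame p v w) (coord p v w).
Proof.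
move=> d0 [a b]; rewrite /coord /frame; congr pair;
  apply: (mulIf d0); rewrite divfK//; rewrite /det2/= /GRing.scale/=; ring.
Qed.

Lemma coordK p v w : det2 v w != 0 -> cancel (coord p v w) (frame p v w).
Proof.
move=> d0 [a b]; rewrite /coord /frame; congr pair;
  rewrite /= /GRing.scale/=; apply: (mulIf d0); rewrite !mulrDl -!mulrA;
  rewrite ![_^-1 * (_ * _)]mulrCA mulVf// /det2/=; ring.
Qed.

Lemma coord1_shift p v w x e h : det2 v w != 0 ->
  (coord p v w (h *: e + x)).1 = h * (det2 e w / det2 v w) + (coord p v w x).1.
Proof.
move=> d0; rewrite /coord /=; apply: (mulIf d0).
rewrite [RHS]mulrDl -(mulrA h) !divfK// /det2/= /GRing.scale/=; ring.
Qed.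

Lemma coord2_shift p v w x e h : det2 v w != 0 ->
  (coord p v w (h *: e + x)).2 = h * (det2 v e / det2 v w) + (coord p v w x).2.
Proof.
move=> d0; rewrite /coord /=; apply: (mulIf d0).
rewrite [RHS]mulrDl -(mulrA h) !divfK// /det2/= /GRing.scale/=; ring.
Qed.

Lemma continuous_coord1 p v w : continuous (fun x => (coord p v w x).1).
Proof.
move=> x; rewrite /coord/= /det2; apply: cvgM; last exact: cvg_cst.
apply: cvgB; apply: cvgM; try exact: cvg_cst.
- by apply: continuous_cvg; [exact: cvg_fst|apply: cvgB; [exact: cvg_id|exact: cvg_cst]].
- by apply: continuous_cvg; [exact: cvg_snd|apply: cvgB; [exact: cvg_id|exact: cvg_cst]].
Qed.

Lemma continuous_coord2 p v w : continuous (fun x => (coord p v w x).2).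
Proof.
move=> x; rewrite /coord/= /det2; apply: cvgM; last exact: cvg_cst.
apply: cvgB; apply: cvgM; try exact: cvg_cst.
- by apply: continuous_cvg; [exact: cvg_snd|apply: cvgB; [exact: cvg_id|exact: cvg_cst]].
- by apply: continuous_cvg; [exact: cvg_fst|apply: cvgB; [exact: cvg_id|exact: cvg_cst]].
Qed.

End charts.

(** * Blocks and the vector fields built from them *)

Section blocks.
Context {R : realType}.
Implicit Types (p v w y e : R * R) (s t : R).

(** A block is a bump of radius [blk_r] around [blk_t] in the second
    coordinate, times a difference of two steps of width [blk_rho], centred at
    [blk_c] and [blk_c'], in the first coordinate.  The derivative of that
    difference, [blk_tent], has mean value zero: integrating it against the
    indicator of a set compares the density of the set around [blk_c] with its
    density around [blk_c']. *)
Record block := Block {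
  blk_t : R; blk_r : R; blk_c : R; blk_c' : R; blk_rho : R }.
Implicit Types b : block.

Definition blk_step b (s : R) : R :=
  step ((s - blk_c b) / blk_rho b) - step ((s - blk_c' b) / blk_rho b).

Definition blk_tent b (s : R) : R :=
  (tent ((s - blk_c b) / blk_rho b) - tent ((s - blk_c' b) / blk_rho b))
  / blk_rho b.

Definition blk_bell b (t : R) : R := bell ((t - blk_t b) / blk_r b).
Definition blk_dbell b (t : R) : R :=
  dbell ((t - blk_t b) / blk_r b) / blk_r b.

Definition blk b y : R := blk_step b y.1 * blk_bell b y.2.
Definition blk_d1 b y : R := blk_tent b y.1 * blk_bell b y.2.
Definition blk_d2 b y : R := blk_step b y.1 * blk_dbell b y.2.

Lemma is_derive_rescale (f : R -> R) (c r s d : R) :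
  is_derive ((s - c) / r) 1 f d -> is_derive s 1 (fun s => f ((s - c) / r)) (d / r).
Proof.
move=> fd; have dl : is_derive s 1 (fun s => (s - c) / r) r^-1.
  split.
    have -> : (fun s => (s - c) / r) = r^-1 *: (id - cst c).
      by apply/funext => u; rewrite /= /GRing.scale/= mulrC.
    by apply: derivableZ; apply: derivableB.
  have -> : (fun s => (s - c) / r) = r^-1 *: (id - cst c).
    by apply/funext => u; rewrite /= /GRing.scale/= mulrC.
  rewrite deriveZ; last by apply: derivableB.
  by rewrite deriveB// derive_id derive_cst subr0 [LHS]mulr1.
have := @is_derive1_comp R f (fun s => (s - c) / r) s d r^-1 fd dl.
by rewrite mulrC.
Qed.

Lemma is_derive_blk_step b s : is_derive s 1 (blk_step b) (blk_tent b s).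
Proof.
rewrite /blk_tent mulrBl /blk_step.
by apply: is_deriveB; apply: is_derive_rescale; exact: is_derive_step.
Qed.

Lemma is_derive_blk_bell b t : is_derive t 1 (blk_bell b) (blk_dbell b t).
Proof. by apply: is_derive_rescale; exact: is_derive_bell. Qed.

Lemma continuous_rescale (f : R -> R) (c r : R) : continuous f ->
  continuous (fun s => f ((s - c) / r)).
Proof.
move=> cf s; apply: (@continuous_cvg _ _ _ _ _ _ f); first exact: cf.
apply: cvgM; last exact: cvg_cst.
by apply: cvgB; [exact: cvg_id|exact: cvg_cst].
Qed.

Lemma continuous_is_derive (f df : R -> R) :
  (forall x : R, is_derive x 1 f (df x)) -> continuous f.
Proof.
move=> fd x; apply: differentiable_continuous.
by apply/derivable1_diffP; have [] := fd x.
Qed.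

Lemma continuous_blk_step b : continuous (blk_step b).
Proof. exact: continuous_is_derive (is_derive_blk_step b). Qed.

Lemma continuous_blk_bell b : continuous (blk_bell b).
Proof. exact: continuous_is_derive (is_derive_blk_bell b). Qed.

Lemma continuous_blk_tent b : continuous (blk_tent b).
Proof.
move=> s; apply: cvgM; last exact: cvg_cst.
by apply: cvgB; apply: continuous_rescale; exact: continuous_tent.
Qed.

Lemma continuous_blk_dbell b : continuous (blk_dbell b).
Proof.
move=> s; apply: cvgM; last exact: cvg_cst.
by apply: continuous_rescale; exact: continuous_dbell.
Qed.

Lemma is_derive_blk p v w b x e : det2 v w != 0 ->
  is_derive x e (blk b \o coord p v w)
    (det2 e w / det2 v w * blk_d1 b (coord p v w x) +
     det2 v e / det2 v w * blk_d2 b (coord p v w x)).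
Proof.
move=> d0.
have d1 := @is_derive_affine _ _ (fun x => (coord p v w x).1) _ _ _ _ (coord1_shift p x e ^~ d0)
  (is_derive_blk_step b (coord p v w x).1).
have d2 := @is_derive_affine _ _ (fun x => (coord p v w x).2) _ _ _ _ (coord2_shift p x e ^~ d0)
  (is_derive_blk_bell b (coord p v w x).2).
apply: (is_derive_eq (is_deriveM d1 d2)).
rewrite /= /blk_d1 /blk_d2 /GRing.scale/=.
ring.
Qed.

Lemma continuous_blk_d p v w b :
  continuous (blk_d1 b \o coord p v w) /\ continuous (blk_d2 b \o coord p v w).
Proof.
split=> x; apply: cvgM.
- by apply: continuous_cvg; [exact: continuous_blk_tent|exact: continuous_coord1].
- by apply: continuous_cvg; [exact: continuous_blk_bell|exact: continuous_coord2].
- by apply: continuous_cvg; [exact: continuous_blk_step|exact: continuous_coord1].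
- by apply: continuous_cvg; [exact: continuous_blk_dbell|exact: continuous_coord2].
Qed.

Lemma blk_step_le1 b s : `|blk_step b s| <= 1.
Proof.
rewrite /blk_step; set a := _ / _; set c := _ / _.
have := step_ge0 a; have := step_ge0 c; have := step_le1 a; have := step_le1 c.
rewrite ler_norml => ? ? ? ?; apply/andP; split; lra.
Qed.

Lemma blk_bell_out b t : 0 < blk_r b -> blk_r b <= `|t - blk_t b| ->
  blk_bell b t = 0.
Proof.
move=> r0 h; apply: bell_out.
by rewrite normrM normfV (gtr0_norm r0) ler_pdivlMr// mul1r.
Qed.

Lemma blk_step_out b s : 0 < blk_rho b ->
  s <= Num.min (blk_c b) (blk_c' b) - blk_rho b \/
  Num.max (blk_c b) (blk_c' b) + blk_rho b <= s -> blk_step b s = 0.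
Proof.
move=> r0 [h|h]; rewrite /blk_step.
- have [h1 h2] : s <= blk_c b - blk_rho b /\ s <= blk_c' b - blk_rho b.
    by move: h; rewrite lerBrDr le_min => /andP[? ?]; split; lra.
  by rewrite !step_left ?subrr// ler_pdivrMr//; lra.
- have [h1 h2] : blk_c b + blk_rho b <= s /\ blk_c' b + blk_rho b <= s.
    by move: h; rewrite -lerBrDr ge_max => /andP[? ?]; split; lra.
  by rewrite !step_right ?subrr// ler_pdivlMr//; lra.
Qed.

End blocks.

Section test_fields.
Context {R : realType} {I : choiceType}.
Variables (p v w : R * R) (k : R) (s : seq I) (b : I -> @block R).
Hypothesis vw0 : det2 v w != 0.
Implicit Types (x e : R * R).

Definition test_fun x : R := k * \sum_(i <- s) blk (b i) (coord p v w x).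

Definition test_field x : R * R := test_fun x *: v.

(** The derivative of [test_fun] in direction [e], by Cramer's rule. *)
Definition test_der e x : R :=
  k * \sum_(i <- s) (det2 e w / det2 v w * blk_d1 (b i) (coord p v w x) +
                     det2 v e / det2 v w * blk_d2 (b i) (coord p v w x)).

Lemma is_derive_sum_seq (F : I -> R * R -> R) (dF : I -> R) x e (r : seq I) :
  (forall i, is_derive x e (F i) (dF i)) ->
  is_derive x e (fun x => \sum_(i <- r) F i x) (\sum_(i <- r) dF i).
Proof.
move=> FdF; elim: r => [|i r ih].
  have -> : (fun x => \sum_(i <- [::]) F i x) = cst 0.
    by apply/funext => y; rewrite big_nil.
  by rewrite big_nil; exact: is_derive_cst.
have -> : (fun x => \sum_(i <- i :: r) F i x) =
          F i + (fun x => \sum_(i <- r) F i x).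
  by apply/funext => y; rewrite big_cons.
by rewrite big_cons; exact: is_deriveD.
Qed.

Lemma is_derive_test_fun c x e :
  is_derive x e (fun x => test_fun x * c) (test_der e x * c).
Proof.
have -> : (fun x => test_fun x * c) =
    (k * c) *: (fun x => \sum_(i <- s) (blk (b i) \o coord p v w) x).
  by apply/funext => y; rewrite /test_fun /= mulrAC.
rewrite /test_der mulrAC.
apply: is_deriveZ; apply: (@is_derive_sum_seq _ (fun i => _)) => i.
exact: is_derive_blk.
Qed.

Lemma continuous_sum_seq (T : topologicalType) (F : I -> T -> R) (r : seq I) :
  (forall i, continuous (F i)) -> continuous (fun x : T => \sum_(i <- r) F i x).
Proof.
move=> cF x; elim: r => [|i r ih].
  have -> : (fun x : T => \sum_(i <- [::]) F i x) = cst 0.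
    by apply/funext => y; rewrite big_nil.
  exact: cvg_cst.
have -> : (fun x : T => \sum_(i <- i :: r) F i x) =
          F i + (fun x : T => \sum_(i <- r) F i x).
  by apply/funext => y; rewrite big_cons.
by apply: continuousD => //; exact: cF.
Qed.

Lemma continuous_test_der e : continuous (test_der e).
Proof.
move=> x; apply: cvgM; first exact: cvg_cst.
apply: (@continuous_sum_seq _ (fun i x => _)) => i {}x.
have [c1 c2] := continuous_blk_d p v w (b i).
apply: cvgD; apply: cvgM; try exact: cvg_cst.
- exact: c1.
- exact: c2.
Qed.

Lemma class_C1_test_fun c : class_C 1 setT (fun x => test_fun x * c).
Proof.
have der e : 'D_e (fun x => test_fun x * c) = (fun x => test_der e x * c).
  by apply/funext => x; apply: (@derive_val _ _ _ _ _ _ _ (is_derive_test_fun c x e)).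
have cder e : continuous (fun x => test_der e x * c).
  by move=> x; apply: cvgM; [exact: continuous_test_der|exact: cvg_cst].
split=> /=.
- by move=> x _; split; apply: ex_derive; exact: is_derive_test_fun.
- by rewrite der => x _; exact: cder.
- by rewrite der => x _; exact: cder.
Qed.

(** The field points in the direction [v] of the first coordinate, so its
    divergence is the derivative in the first coordinate alone: the derivatives
    of the bumps, which are not controlled, cancel. *)
Lemma divergence_test_field x :
  divergence test_field x = k * \sum_(i <- s) blk_d1 (b i) (coord p v w x).
Proof.
rewrite /divergence.
have -> : fst \o test_field = (fun x => test_fun x * v.1) by [].
have -> : snd \o test_field = (fun x => test_fun x * v.2) by [].
rewrite (@derive_val _ _ _ _ _ _ _ (is_derive_test_fun v.1 x e1)).
rewrite (@derive_val _ _ _ _ _ _ _ (is_derive_test_fun v.2 x e2)).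
rewrite /test_der -!mulrA -mulrDr; congr (_ * _).
rewrite !mulr_suml -big_split; apply: eq_bigr => i _ /=.
by move: vw0; rewrite /det2 /e1 /e2 /= => d0; field.
Qed.

Hypothesis r_gt0 : forall i, i \in s -> 0 < blk_r (b i).
Hypothesis rho_gt0 : forall i, i \in s -> 0 < blk_rho (b i).

(** A closed rectangle outside which the block vanishes. *)
Definition blk_box (c : @block R) : set (R * R) := [set y |
  [/\ Num.min (blk_c c) (blk_c' c) - blk_rho c <= y.1,
      y.1 <= Num.max (blk_c c) (blk_c' c) + blk_rho c,
      blk_t c - blk_r c <= y.2 & y.2 <= blk_t c + blk_r c]].

Lemma blk_neq0 i y : i \in s -> blk (b i) y != 0 ->
  blk_box (b i) y /\ `|y.2 - blk_t (b i)| < blk_r (b i).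
Proof.
move=> si; rewrite /blk mulf_eq0 negb_or => /andP[h1 h2].
have hr : `|y.2 - blk_t (b i)| < blk_r (b i).
  rewrite ltNge; apply: contraNN h2 => h.
  by rewrite blk_bell_out// r_gt0.
split => //; move: hr; rewrite ltr_norml => /andP[hr1 hr2].
split; try lra.
- rewrite leNgt; apply: contraNN h1 => h; apply/eqP.
  by apply: blk_step_out; [exact: rho_gt0|left; exact: ltW].
- rewrite leNgt; apply: contraNN h1 => h; apply/eqP.
  by apply: blk_step_out; [exact: rho_gt0|right; exact: ltW].
Qed.

Lemma closed_blk_box (c : @block R) :
  closed (coord p v w @^-1` blk_box c).
Proof.
have -> : coord p v w @^-1` blk_box c =
  ((fun x => (coord p v w x).1) @^-1`
     `[Num.min (blk_c c) (blk_c' c) - blk_rho c,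
       Num.max (blk_c c) (blk_c' c) + blk_rho c]%classic) `&`
  ((fun x => (coord p v w x).2) @^-1`
     `[blk_t c - blk_r c, blk_t c + blk_r c]%classic).
  apply/seteqP; split=> x /=; rewrite !in_itv/=.
    by move=> [-> -> -> ->].
  by move=> [/andP[? ?] /andP[? ?]]; split.
apply: closedI; apply: preimage_closed => //; try exact: interval_closed.
- by move=> x _; exact: continuous_coord1.
- by move=> x _; exact: continuous_coord2.
Qed.

Lemma supp_test_field : supp test_field `<=`
  \bigcup_(i in [set` s]) (coord p v w @^-1` blk_box (b i)).
Proof.
have cl : closed (\bigcup_(i in [set` s]) (coord p v w @^-1` blk_box (b i))).
  rewrite bigcup_seq.
  elim: s => [|i r ih]; first by rewrite big_nil; exact: closed0.
  by rewrite big_cons; apply: closedU => //; exact: closed_blk_box.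
rewrite /supp closureE; apply: smallest_sub => // x /= nz.
apply: contrapT => nx; move/negP: nz; apply.
rewrite /test_field /test_fun big_seq big1 ?mulr0 ?scale0r// => i si.
apply/eqP/negPn/negP => /(blk_neq0 si) [h _].
by apply: nx; exists i.
Qed.

(** Blocks whose bumps live over disjoint intervals have disjoint supports, so
    the size of the field does not depend on how many blocks are added. *)
Lemma test_fun_le : uniq s -> trivIset [set` s] (fun i => ball (blk_t (b i)) (blk_r (b i))) ->
  0 <= k -> forall x, `|test_fun x| <= k.
Proof.
move=> us triv k0 x; rewrite normrM (ger0_norm k0) ler_piMr//.
have [[i si nz]|none] := pselect (exists2 i, i \in s & blk (b i) (coord p v w x) != 0).
  rewrite (bigD1_seq i)//= big_seq_cond big1 ?addr0.
    rewrite /blk normrM mulr_ile1// ?blk_step_le1//.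
    by rewrite ger0_norm ?bell_ge0 ?bell_le1.
  move=> j /andP[sj ij]; apply/eqP/negPn/negP => nzj.
  have [_ hi] := blk_neq0 si nz; have [_ hj] := blk_neq0 sj nzj.
  move: triv => /(_ j i sj si) ji; move/eqP: ij; apply; apply: ji.
  by exists (coord p v w x).2; split; rewrite /ball/= distrC.
rewrite big_seq big1 ?normr0// => i si; apply/eqP/negPn/negP => nz.
by apply: none; exists i.
Qed.

End test_fields.

(** * The Euclidean norm and the polar function *)

Section euclidean.
Context {R : realType}.
Implicit Types (x y : R * R).

Lemma dot_ge0 x : 0 <= dot x x.
Proof. by rewrite /dot -!expr2 addr_ge0// sqr_ge0. Qed.

Lemma enorm_ge0 x : 0 <= enorm x.
Proof. exact: sqrtr_ge0. Qed.

Lemma enorm_sqr x : enorm x ^+ 2 = dot x x.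
Proof. by rewrite sqr_sqrtr// dot_ge0. Qed.

Lemma enormZ (a : R) x : enorm (a *: x) = `|a| * enorm x.
Proof.
rewrite /enorm; have -> : dot (a *: x) (a *: x) = a ^+ 2 * dot x x.
  by rewrite /dot/= /GRing.scale/=; ring.
by rewrite sqrtrM ?sqr_ge0// sqrtr_sqr.
Qed.

Lemma enorm_gt0 x : x != 0 -> 0 < enorm x.
Proof.
move=> x0; rewrite sqrtr_gt0 lt0r dot_ge0 andbT.
apply: contra x0; rewrite /dot -!expr2 paddr_eq0 ?sqr_ge0// !sqrf_eq0.
by case: x => a c /= /andP[/eqP -> /eqP ->].
Qed.

Lemma dot_le x y : dot x y <= enorm x * enorm y.
Proof.
have [h|h] := leP (dot x y) 0.
  by rewrite (le_trans h)// mulr_ge0 ?enorm_ge0.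
rewrite -(@ler_pXn2r _ 2)// ?nnegrE ?(ltW h) ?mulr_ge0 ?enorm_ge0//.
rewrite exprMn !enorm_sqr /dot -subr_ge0.
have -> : (x.1 * x.1 + x.2 * x.2) * (y.1 * y.1 + y.2 * y.2) -
  (x.1 * y.1 + x.2 * y.2) ^+ 2 = (x.1 * y.2 - x.2 * y.1) ^+ 2 by ring.
exact: sqr_ge0.
Qed.

(** By Cauchy-Schwarz, [dot x z <= enorm x * alpha <= H x]. *)
Lemma polar_le1 (H : R * R -> R) (alpha : R) (z : R * R) : 0 < alpha ->
  (forall x, alpha * enorm x <= H x) -> enorm z <= alpha -> polar H z <= 1.
Proof.
move=> a0 Ha za; apply: ge_sup.
  exists (dot (1, 0) z / H (1, 0)); exists (1, 0) => //=.
  by apply/eqP => -[] /eqP; rewrite oner_eq0.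
move=> _ [x /= x0 <-]; have H0 : 0 < H x.
  by apply: lt_le_trans (Ha x); rewrite mulr_gt0// enorm_gt0//; exact/eqP.
rewrite ler_pdivrMr// mul1r (le_trans (dot_le _ _))// (le_trans _ (Ha x))//.
by rewrite mulrC ler_wpM2r// enorm_ge0.
Qed.

End euclidean.

(** * Affine changes of variables *)

Section change_of_variables.
Context {R : realType}.
Local Notation T := (measurableTypeR R).
Local Notation lam := (@lebesgue_measure R).
Local Notation lam2 := (@borel_lebesgue2 R).

Definition image_measure d1 d2 (X : measurableType d1) (Y : measurableType d2)
    (mu : {measure set X -> \bar R}) (f : X -> Y) (mf : measurable_fun setT f) :
    {measure set Y -> \bar R} :=
  measure_function_pushforward__canonical__measure_function_Measure mu mf.

Lemma measurable_affine (a b : R) : measurable_fun [set: T] ((fun x => a * x + b) : T -> T).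
Proof.
by apply: measurable_funD => //; exact: measurable_funM.
Qed.

(** The rescaled image measure agrees with Lebesgue measure on intervals, and
    is therefore equal to it. *)
Lemma lebesgue_measure_affine (a b : R) (A : set T) : a != 0 -> measurable A ->
  lam ((fun x => a * x + b) @^-1` A) = (`|a|^-1%:E * lam A)%E.
Proof.
move=> a0 mA.
have na0 : 0 <= `|a| by [].
pose f : T -> T := fun x => a * x + b.
have mf : measurable_fun setT f by exact: measurable_affine.
pose mu : {measure set T -> \bar R} := mscale (NngNum na0) (image_measure lam mf).
suff -> : lam A = (`|a|%:E * lam (f @^-1` A))%E.
  by rewrite muleA -EFinM mulVf ?normr_eq0// mul1e.
have muE X : mu X = (`|a|%:E * lam (f @^-1` X))%E by [].
rewrite -muE; apply: lebesgue_measure_unique => // X [[c d] _ <-] /=.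
rewrite muE.
rewrite lebesgue_measure_itv/= lte_fin.
have [a_gt0|a_lt0|/eqP] := ltgtP 0 a; last by rewrite eq_sym (negbTE a0).
- have -> : f @^-1` `]c, d] = `](c - b) / a, (d - b) / a]%classic.
    apply/seteqP; split=> x; rewrite /f /= !in_itv/= ltr_pdivrMr// ler_pdivlMr//.
      by rewrite mulrC => /andP[? ?]; apply/andP; split; lra.
    by rewrite mulrC => /andP[? ?]; apply/andP; split; lra.
  rewrite lebesgue_measure_itv/= lte_fin ltr_pM2r ?invr_gt0// ltrD2r.
  case: ifPn => _; last by rewrite mule0.
  rewrite -!EFinB -EFinM gtr0_norm// -mulrBl mulrCA divff// mulr1.
  by congr _%:E; ring.
- have -> : f @^-1` `]c, d] = `[(d - b) / a, (c - b) / a[%classic.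
    apply/seteqP; split=> x; rewrite /f /= !in_itv/= ltr_ndivlMr// ler_ndivrMr//.
      by rewrite mulrC => /andP[? ?]; apply/andP; split; lra.
    by rewrite mulrC => /andP[? ?]; apply/andP; split; lra.
  rewrite lebesgue_measure_itv/= lte_fin ltr_nM2r ?invr_lt0// ltrD2r.
  case: ifPn => _; last by rewrite mule0.
  rewrite -!EFinB -EFinM ltr0_norm// -mulrBl mulNr mulrCA divff// mulr1.
  by congr _%:E; ring.
Qed.

Lemma lam2_xsection (X : set (T * T)) :
  lam2 X = (\int[lam]_x lam (xsection X x))%E.
Proof. by []. Qed.

Lemma lam2_ysection (X : set (T * T)) : measurable X ->
  lam2 X = (\int[lam]_y lam (ysection X y))%E.
Proof.
move=> mX.
apply: (@product_measure_unique _ _ T T R lam lam (lam \x^ lam)%E) => // A B mA mB.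
by rewrite [LHS]product_measure2E.
Qed.

(** Multiplying the measure of every preimage by a fixed constant is what a
    linear change of variables does.  The property is stable under composition,
    so that it is enough to check it for the swap of the coordinates and for
    shears. *)
Definition scales_measure (S : T * T -> T * T) (c : R) :=
  [/\ 0 < c, measurable_fun setT S &
    forall A, measurable A -> lam2 (S @^-1` A) = (c%:E * lam2 A)%E].

Lemma scales_measure_comp S1 S2 c1 c2 :
  scales_measure S1 c1 -> scales_measure S2 c2 ->
  scales_measure (S1 \o S2) (c1 * c2).
Proof.
move=> [c1_gt0 mS1 h1] [c2_gt0 mS2 h2]; split; first exact: mulr_gt0.
  exact: measurableT_comp.
move=> A mA; rewrite comp_preimage h2 ?h1//; first by rewrite EFinM muleCA muleA.
by rewrite -[X in measurable X]setTI; exact: mS1.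
Qed.

Lemma scales_measure_rect S c : 0 < c -> measurable_fun setT S ->
  (forall A B, measurable A -> measurable B ->
    lam2 (S @^-1` (A `*` B)) = (c%:E * (lam A * lam B))%E) ->
  scales_measure S c.
Proof.
move=> c0 mS h; split => // A mA.
have c'0 : 0 <= c^-1 by rewrite invr_ge0 ltW.
pose mu : {measure set (T * T) -> \bar R} :=
  mscale (NngNum c'0) (image_measure lam2 mS).
have muE X : mu X = (c^-1%:E * lam2 (S @^-1` X))%E by [].
have -> : lam2 A = mu A.
  apply: (@product_measure_unique _ _ T T R lam lam mu) => // X Y mX mY.
  by rewrite muE h// muleA -EFinM mulVf ?gt_eqF// mul1e.
by rewrite muE muleA -EFinM divff ?gt_eqF// mul1e.
Qed.

Lemma scales_measure_swap : scales_measure (fun y => (y.2, y.1)) 1.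
Proof.
apply: scales_measure_rect => //.
  by apply: measurable_fun_pair; [exact: measurable_snd|exact: measurable_fst].
move=> A B mA mB; rewrite mul1e.
have -> : (fun y : T * T => (y.2, y.1)) @^-1` (A `*` B) = B `*` A.
  by apply/seteqP; split => -[x y] [].
by rewrite [LHS]product_measure1E// muleC.
Qed.

Lemma scales_measure_fst (a : R) (g : T -> T) : a != 0 -> measurable_fun setT g ->
  scales_measure (fun y => (a * y.1 + g y.2, y.2)) `|a|^-1.
Proof.
move=> a0 mg.
have mS : measurable_fun setT (fun y : T * T => (a * y.1 + g y.2 : T, y.2 : T)).
  apply: measurable_fun_pair; last exact: measurable_snd.
  apply: (@measurable_funD _ _ _ setT (fun y : T * T => a * y.1) (fun y => g y.2)).
    by apply: measurable_funM; [exact: measurable_cst|exact: measurable_fst].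
  exact: measurableT_comp.
apply: scales_measure_rect => //; first by rewrite invr_gt0 normr_gt0.
move=> A B mA mB; rewrite lam2_ysection; last first.
  by rewrite -[X in measurable X]setTI; apply: mS => //; exact: measurableX.
transitivity (\int[lam]_y ((`|a|^-1%:E * lam A) * (\1_B y)%:E))%E.
  apply: eq_integral => y _; rewrite indicE.
  have [yB|yB] := boolP (y \in B).
    rewrite mule1 -(lebesgue_measure_affine (g y))//; congr (lam _).
    apply/seteqP; split=> x; rewrite /ysection/= inE/=.
      by move=> [].
    by split => //; exact/set_mem.
  rewrite mule0 (_ : ysection _ _ = set0) ?measure0//.
  apply/seteqP; split=> x //; rewrite /ysection/= inE/= => -[_ yB'].
  by move/negP: yB; apply; exact/mem_set.
rewrite ge0_integralZl//.
- by rewrite integral_indic// setIT muleA.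
- exact/measurable_EFinP.
- by rewrite mule_ge0// lee_fin invr_ge0.
Qed.

Lemma scales_measure_snd (a : R) (g : T -> T) : a != 0 -> measurable_fun setT g ->
  scales_measure (fun y => (y.1, a * y.2 + g y.1)) `|a|^-1.
Proof.
move=> a0 mg.
have h := scales_measure_comp (scales_measure_comp scales_measure_swap
  (scales_measure_fst a0 mg)) scales_measure_swap.
by rewrite mul1r mulr1 in h.
Qed.

(** A frame whose first vector has a nonzero first component factors as two
    shears, which is Gaussian elimination; otherwise the two vectors are
    swapped first. *)
Lemma scales_measure_frame (p v w : R * R) : det2 v w != 0 ->
  exists c, scales_measure (frame p v w) c.
Proof.
wlog v1 : v w / v.1 != 0.
  move=> wlg d0; have [v10|v10] := eqVneq v.1 0; last exact: wlg.
  have w10 : w.1 != 0.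
    by apply: contra d0 => /eqP w10; rewrite /det2 v10 w10 mul0r mulr0 subrr.
  have d0' : det2 w v != 0.
    by move: d0; rewrite -oppr_eq0; apply: contra => /eqP <-; apply/eqP; rewrite /det2; ring.
  have [c hc] := wlg w v w10 d0'.
  exists (c * 1).
  have := scales_measure_comp hc scales_measure_swap.
  congr scales_measure; apply/funext => -[y1 y2].
  by rewrite /frame/= addrAC.
move=> d0.
pose b := det2 v w / v.1.
have b0 : b != 0 by rewrite mulf_neq0// invr_eq0.
pose f1 (y : T) : T := w.1 * y + p.1.
pose f2 (y : T) : T := v.2 / v.1 * y + (p.2 - v.2 / v.1 * p.1).
exists (`|b|^-1 * `|v.1|^-1).
have := scales_measure_comp (scales_measure_snd b0 (measurable_affine _ _ : measurable_fun setT f2))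
  (scales_measure_fst v1 (measurable_affine _ _ : measurable_fun setT f1)).
congr scales_measure; apply/funext => -[y1 y2].
rewrite /frame/= /f1 /f2 /b /det2 /=; congr pair; rewrite /= /GRing.scale/=.
  by ring.
by field.
Qed.

End change_of_variables.

(** * Slices along horizontal lines *)

Section scaled_indicators.
Context {R : realType}.
Local Notation T := (measurableTypeR R).
Local Notation lam := (@lebesgue_measure R).

Lemma integrable_cindic (A : set T) (c : R) : measurable A -> (lam A < +oo)%E ->
  lam.-integrable setT (fun s => (c * \1_A s)%:E).
Proof.
move=> mA finA.
apply: (@integrableZl _ _ _ _ _ measurableT c (fun s : T => (\1_A s)%:E)).
apply/integrableP; split; first exact/measurable_EFinP/measurable_indic.
under eq_integral do rewrite gee0_abs ?lee_fin//.
by rewrite integral_indic//= setIT.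
Qed.

Lemma integral_cindic (A : set T) (c : R) : measurable A -> 0 <= c ->
  (\int[lam]_s (c * \1_A s)%:E = c%:E * lam A)%E.
Proof.
move=> mA c0; under eq_integral do rewrite EFinM.
rewrite ge0_integralZl//; last exact/measurable_EFinP/measurable_indic.
by rewrite integral_indic//= setIT.
Qed.

End scaled_indicators.

Section slices.
Context {R : realType}.
Local Notation T := (measurableTypeR R).
Local Notation lam := (@lebesgue_measure R).
Local Notation lam2 := (@borel_lebesgue2 R).

Definition unit_square : set (T * T) := `]0, 1[ `*` `]0, 1[.

Lemma measurable_unit_square : measurable unit_square.
Proof. by apply: measurableX; exact: measurable_itv. Qed.

Lemma lam2_unit_square : lam2 unit_square = 1%E.
Proof.
by rewrite [LHS]product_measure1E//= lebesgue_measure_itv/= lte_fin ltr01 oppr0 adde0 mule1.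
Qed.

Variable F : set (T * T).
Hypotheses (mF : measurable F) (F_sub : F `<=` unit_square).

Lemma lam2_fin : (lam2 F < +oo)%E.
Proof.
apply: (@le_lt_trans _ _ (lam2 unit_square)).
  by apply: le_measure; rewrite ?inE//; exact: measurable_unit_square.
by rewrite lam2_unit_square ltry.
Qed.

Lemma integrable_bounded_on (f : T * T -> R) (M : R) :
  measurable_fun setT f -> (forall y, `|f y| <= M) ->
  lam2.-integrable setT (fun y => (\1_F y * f y)%:E).
Proof.
move=> mf fM.
have iF : lam2.-integrable setT (fun y => (M * \1_F y)%:E).
  apply/integrableP; split.
    by apply/measurable_EFinP; apply: measurable_funM => //; exact: measurable_indic.
  apply: (@le_lt_trans _ _ (\int[lam2]_y (`|M|%:E * (\1_F y)%:E)))%E.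
    apply: ge0_le_integral => //.
    - apply: measurableT_comp => //; apply/measurable_EFinP.
      by apply: measurable_funM => //; exact: measurable_indic.
    - by apply/measurable_EFinP; apply: measurable_funM.
    - by move=> y _; rewrite -EFinM /= lee_fin normrM ler_wpM2l// ger0_norm.
  rewrite ge0_integralZl//.
  - rewrite integral_indic// setIT lte_mul_pinfty//; exact: lam2_fin.
  - exact/measurable_EFinP.
apply: le_integrable iF => //.
- by apply/measurable_EFinP; apply: measurable_funM => //; exact: measurable_indic.
- move=> y _ /=; rewrite lee_fin !normrM mulrC ler_wpM2r//.
  by rewrite (le_trans (fM y))// ler_norm.
Qed.

(** The integral of [phi] over the slice of [F] at height [t]. *)
Definition slice_int (phi : R -> R) (t : R) : R :=
  fine (\int[lam]_s (\1_F (s, t) * phi s)%:E)%E.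

Section slice_int.
Variables (phi : R -> R) (M : R).
Hypotheses (mphi : measurable_fun (setT : set T) (phi : T -> R))
  (phiM : forall s, `|phi s| <= M).

Let M0 : 0 <= M. Proof. exact: le_trans (phiM 0). Qed.

Lemma mphi_fst : measurable_fun (setT : set (T * T)) (fun y : T * T => phi y.1).
Proof. by apply: measurableT_comp => //; exact: measurable_fst. Qed.

Lemma slice_measurable t : measurable_fun (setT : set T)
  (fun s : T => \1_F (s, t) * phi s).
Proof.
apply: measurable_funM => //.
apply: (@measurableT_comp _ _ _ _ _ _ (\1_F : T * T -> R) _ (fun s : T => (s, t))).
  exact: measurable_indic.
exact: measurable_pair2.
Qed.

Lemma slice_bound t s : `|\1_F (s, t) * phi s| <= M * \1_(`]0, 1[%classic : set T) s.
Proof.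
rewrite normrM !indicE; have [/set_mem Fst|_] := boolP ((s, t) \in F).
  have [s01 _] := F_sub Fst.
  by rewrite (mem_set s01) normr1 mul1r mulr1.
by rewrite normr0 mul0r mulr_ge0.
Qed.

Lemma integrable_unit_itv (c : R) :
  lam.-integrable setT (fun s : T => (c * \1_(`]0, 1[%classic : set T) s)%:E).
Proof.
apply: integrable_cindic => //.
by rewrite /= lebesgue_measure_itv/= lte_fin ltr01 ltry.
Qed.

Lemma slice_integrable t :
  lam.-integrable setT (fun s => (\1_F (s, t) * phi s)%:E).
Proof.
apply: le_integrable (integrable_unit_itv M) => //.
  by apply/measurable_EFinP; exact: slice_measurable.
by move=> s _; rewrite lee_fin (le_trans (slice_bound t s))// ler_norm.
Qed.

Lemma slice_intE t :
  (slice_int phi t)%:E = (\int[lam]_s (\1_F (s, t) * phi s)%:E)%E.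
Proof. by rewrite fineK//; apply: integrable_fin_num => //; exact: slice_integrable. Qed.

Lemma slice_int_out t : ~ (0 < t < 1) -> slice_int phi t = 0.
Proof.
move=> t01; rewrite /slice_int integral0_eq// => s _.
rewrite indicE memNset ?mul0r// => /F_sub [_]; rewrite /= in_itv/=; exact: t01.
Qed.

Lemma measurable_slice_int : measurable_fun (setT : set T) (slice_int phi : T -> R).
Proof.
apply: measurableT_comp => //.
have i := integrable_bounded_on mphi_fst (fun y => phiM y.1).
exact: (measurable_fubini_G i).
Qed.

Lemma slice_int_bound t : `|slice_int phi t| <= M.
Proof.
rewrite -lee_fin -abse_EFin slice_intE.
apply: (le_trans (le_abse_integral _ _ _)) => //.
  by apply/measurable_EFinP; exact: slice_measurable.
apply: (@le_trans _ _ (\int[lam]_s (M%:E * (\1_(`]0, 1[%classic : set T) s)%:E))%E).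
  apply: ge0_le_integral => //.
  - by apply: measurableT_comp => //; apply/measurable_EFinP; exact: slice_measurable.
  - by apply/measurable_EFinP; apply: measurable_funM.
  - by move=> s _; rewrite lee_fin; exact: slice_bound.
rewrite ge0_integralZl//; last exact/measurable_EFinP.
by rewrite integral_indic//= setIT lebesgue_measure_itv/= lte_fin ltr01 oppr0 adde0 mule1.
Qed.

Lemma integrable_slice_int : lam.-integrable setT (fun t : T => (slice_int phi t)%:E).
Proof.
apply: le_integrable (integrable_unit_itv M) => //.
  by apply/measurable_EFinP; exact: measurable_slice_int.
move=> t _; rewrite /= lee_fin [leRHS]ger0_norm ?mulr_ge0// indicE.
have [t01|t01] := boolP (t \in _); first by rewrite mulr1 slice_int_bound.
rewrite slice_int_out ?normr0 ?mulr_ge0//.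
by move/negP: t01 => + t01; apply; apply/mem_set; rewrite /= in_itv.
Qed.

(** Fubini, which reduces the action of a block on [F] to a function of the
    height alone. *)
Lemma integral_slice_int (psi : R -> R) (K : R) :
  measurable_fun (setT : set T) (psi : T -> R) -> (forall t, `|psi t| <= K) ->
  (\int[lam2]_(y in F) (phi y.1 * psi y.2)%:E =
   \int[lam]_t (psi t * slice_int phi t)%:E)%E.
Proof.
move=> mpsi psiK.
have mprod : measurable_fun setT (fun y : T * T => phi y.1 * psi y.2).
  apply: measurable_funM; first exact: mphi_fst.
  by apply: measurableT_comp => //; exact: measurable_snd.
have i := integrable_bounded_on mprod
  (fun y => _ : `|phi y.1 * psi y.2| <= M * K).
rewrite integral_mkcond.
transitivity (\int[lam2]_y (\1_F y * (phi y.1 * psi y.2))%:E)%E.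
  apply: eq_integral => y _; rewrite patchE indicE.
  by case: ifP => _; rewrite ?mul1r ?mul0r.
rewrite -[LHS]integral21_prod_meas1; last first.
  by apply: i => y; rewrite normrM ler_pM.
apply: eq_integral => t _.
rewrite EFinM slice_intE -integralZl//; last exact: slice_integrable.
by apply: eq_integral => s _; rewrite -EFinM; congr _%:E; ring.
Qed.

End slice_int.

End slices.

(** * Lebesgue points tested against a bump *)

Section lebesgue_points.
Context {R : realType}.
Local Notation T := (measurableTypeR R).
Local Notation lam := (@lebesgue_measure R).

Lemma measurable_bell_rescale (t0 r : R) :
  measurable_fun (setT : set T) (fun t : T => bell ((t - t0) / r)).
Proof.
apply: continuous_measurable_fun; apply: continuous_rescale.
exact: continuous_is_derive is_derive_bell.
Qed.

(** The bump is at least 1/2 on an interval of length [r], which contributes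
    [theta / 2 * r].  Replacing [h] by its value at [t0] costs at most the
    integral of [`|h t - h t0|] over the ball of radius [r]; at a Lebesgue point
    this is eventually at most [theta / 8] times the length [2 * r]. *)
Lemma lebesgue_pt_bell (h : R -> R) (t0 theta : R) :
  lam.-integrable setT (fun t : T => (h t)%:E) ->
  lebesgue_pt h t0 -> 0 < theta -> theta <= h t0 ->
  \forall r \near 0^'+,
    ((theta / 4 * r)%:E <= \int[lam]_t (bell ((t - t0) / r) * h t)%:E)%E.
Proof.
move=> ih /fine_cvgP[fin cv] th0 hth.
have e0 : 0 < theta / 8 by rewrite divr_gt0.
move/cvgrPdist_le : cv => /(_ _ e0) cv.
have mh : measurable_fun (setT : set T) (h : T -> R).
  by apply/measurable_EFinP; exact: (measurable_int _ ih).
near=> r.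
have r0 : 0 < r by near: r; exact: nbhs_right_gt.
have dr : (davg h t0 r <= (theta / 8)%:E)%E.
  have f1 : davg h t0 r \is a fin_num by near: r; exact: fin.
  rewrite -(fineK f1) lee_fin.
  have : `|0 - fine (davg h t0 r)| <= theta / 8 by near: r; exact: cv.
  by rewrite sub0r normrN => /(le_trans (ler_norm _)).
(* [bell * h] is bounded below by [f1 - f2]. *)
pose f1 (t : T) : R := theta / 2 * \1_(ball t0 (r / 2) : set T) t.
pose f2 (t : T) : R := \1_(ball t0 r : set T) t * `|h t - h t0|.
have i1 : lam.-integrable setT (fun t => (f1 t)%:E).
  apply: (@integrableZl _ _ _ _ _ measurableT (theta / 2)
    (fun t : T => (\1_(ball t0 (r / 2) : set T) t)%:E)).
  apply/integrableP; split.
    by apply/measurable_EFinP/measurable_indic; exact: measurable_ball.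
  under eq_integral do rewrite gee0_abs ?lee_fin//.
  rewrite integral_indic//=; last exact: measurable_ball.
  by rewrite setIT lebesgue_measure_ball ?ltry// ltW// divr_gt0.
have mf2 : measurable_fun setT f2.
  apply: measurable_funM; first by apply: measurable_indic; exact: measurable_ball.
  by apply: measurableT_comp => //; apply: measurable_funB.
have f2E : (\int[lam]_t (f2 t)%:E =
    \int[lam]_(t in ball t0 r) `|(h t - h t0)%:E|)%E.
  rewrite [RHS]integral_mkcond; apply: eq_integral => t _.
  rewrite patchE /f2 indicE; case: ifP => _; first by rewrite mul1r.
  by rewrite mul0r.
have b2 : (\int[lam]_t (f2 t)%:E <= (theta / 4 * r)%:E)%E.
  rewrite f2E; move: dr; rewrite /davg /iavg (lebesgue_measure_ball _ (ltW r0)).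
  have r2 : 0 < r *+ 2 by rewrite mulrn_wgt0.
  rewrite inver gt_eqF// lee_pdivrMl// -EFinM.
  have -> // : r *+ 2 * (theta / 8) = theta / 4 * r.
  by rewrite -mulr_natr; field.
have i2 : lam.-integrable setT (fun t => (f2 t)%:E).
  apply/integrableP; split; first exact/measurable_EFinP.
  under eq_integral do rewrite gee0_abs ?lee_fin ?mulr_ge0//.
  exact: (le_lt_trans b2 (ltry _)).
have i3 : lam.-integrable setT (fun t : T => (bell ((t - t0) / r) * h t)%:E).
  apply: le_integrable ih => //.
    apply/measurable_EFinP; apply: measurable_funM => //.
    exact: measurable_bell_rescale.
  move=> t _ /=; rewrite lee_fin normrM ler_piMl// ger0_norm ?bell_ge0//.
  exact: bell_le1.
apply: (@le_trans _ _ (\int[lam]_t (f1 t)%:E - \int[lam]_t (f2 t)%:E)%E).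
  have -> : (\int[lam]_t (f1 t)%:E = (theta / 2 * r)%:E)%E.
    rewrite /f1; under eq_integral do rewrite EFinM.
    rewrite ge0_integralZl//; last 2 first.
    - by apply/measurable_EFinP/measurable_indic; exact: measurable_ball.
    - by rewrite lee_fin; lra.
    rewrite integral_indic//=; last exact: measurable_ball.
    rewrite setIT lebesgue_measure_ball; last lra.
    by rewrite -EFinM; congr _%:E; rewrite -mulr_natr; field.
  rewrite leeBrDr; last first.
    rewrite ge0_fin_numE ?(le_lt_trans b2 (ltry _))//.
    by apply: integral_ge0 => t _; rewrite lee_fin mulr_ge0.
  apply: (le_trans (leeD2l _ b2)); rewrite -EFinD lee_fin.
  by rewrite -mulrDl; apply: ler_wpM2r; [exact: ltW|lra].
rewrite -(integralB_EFin measurableT i1 i2).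
apply: le_integral => //; first exact: (integrableB measurableT i1 i2).
move=> t _; rewrite -EFinB lee_fin /f1 /f2 !indicE.
have [tr|tr] := boolP (t \in (ball t0 r : set T)); last first.
  have -> : bell ((t - t0) / r) = 0.
    apply: bell_out; rewrite normrM normfV (gtr0_norm r0) ler_pdivlMr// mul1r.
    move/negP: tr; rewrite leNgt => tr; apply/negP => h1; apply: tr.
    by apply/mem_set; rewrite /ball/= distrC.
  rewrite !mul0r subr0.
  have [/set_mem tr2|_] := boolP (t \in _); last by rewrite mulr0.
  exfalso; move/negP: tr; apply; apply/mem_set; apply: le_ball tr2.
  lra.
have bg := bell_ge0 ((t - t0) / r); have bl := bell_le1 ((t - t0) / r).
have hl : h t0 - `|h t - h t0| <= h t.
  by have := ler_norm (h t0 - h t); rewrite distrC; lra.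
have a0 : 0 <= `|h t - h t0| by [].
rewrite mulr1n mul1r.
set be := bell _ in bg bl *; set a := `|_| in hl a0 *.
have key : be * h t0 - a <= be * h t.
  have : be * (h t0 - a) <= be * h t by exact: ler_wpM2l.
  have : be * a <= a by rewrite ler_piMl.
  by rewrite mulrBr; lra.
have [/set_mem tr2|_] := boolP (t \in _).
  have be2 : 2^-1 <= be.
    apply: bell_in; rewrite normrM normfV (gtr0_norm r0) ler_pdivrMr//.
    by move: tr2; rewrite /ball/= distrC => /ltW; rewrite mulrC.
  rewrite mulr1; apply: le_trans key; rewrite lerD2r.
  have : 2^-1 * h t0 <= be * h t0 by apply: ler_wpM2r => //; lra.
  by lra.
rewrite mulr0; apply: le_trans key; rewrite lerD2r mulr_ge0//; lra.
Unshelve. all: by end_near. Qed.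

End lebesgue_points.

(** * A covering bound for lines with a large block *)

Section covering.
Context {R : realType}.
Local Notation T := (measurableTypeR R).
Local Notation lam := (@lebesgue_measure R).
Local Notation lam2 := (@borel_lebesgue2 R).

(** The box of the block has to stay in the domain [D], since test fields
    have compact support there. *)
Definition admissible (D : set (T * T)) (b : @block R) :=
  [/\ 0 < blk_r b, 0 < blk_rho b & blk_box b `<=` D].

(** The bound that a finite perimeter gives on [F] in a chart when only fields
    along the first coordinate are used. *)
Definition variation1_le (D F : set (T * T)) (V : R) :=
  forall (s : seq R) (b : R -> @block R), uniq s ->
    (forall i, i \in s -> admissible D (b i)) ->
    trivIset [set` s] (fun i => ball (blk_t (b i)) (blk_r (b i))) ->
    (\int[lam2]_(y in F) (\sum_(i <- s) blk_d1 (b i) y)%:E <= V%:E)%E.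

Lemma blk_tent_bound (b : @block R) s : 0 < blk_rho b ->
  `|blk_tent b s| <= (blk_rho b)^-1.
Proof.
move=> r0; rewrite /blk_tent normrM normfV (gtr0_norm r0) ler_piMl ?invr_ge0 ?(ltW r0)//.
set x := _ / _; set y := _ / _.
have := tent_ge0 x; have := tent_le1 x; have := tent_ge0 y; have := tent_le1 y.
by rewrite ler_norml => ? ? ? ?; apply/andP; split; lra.
Qed.

Lemma measurable_blk_tent (b : @block R) : measurable_fun (setT : set T) (blk_tent b : T -> R).
Proof. by apply: continuous_measurable_fun; exact: continuous_blk_tent. Qed.

Lemma measurable_blk_bell (b : @block R) : measurable_fun (setT : set T) (blk_bell b : T -> R).
Proof. by apply: continuous_measurable_fun; exact: continuous_blk_bell. Qed.

Lemma blk_bell_bound (b : @block R) t : `|blk_bell b t| <= 1.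
Proof. by rewrite ger0_norm ?bell_ge0 ?bell_le1. Qed.

Lemma measurable_blk_d1 (b : @block R) : measurable_fun setT (blk_d1 b : T * T -> R).
Proof.
apply: measurable_funM.
- exact: (measurableT_comp (measurable_blk_tent b) measurable_fst).
- exact: (measurableT_comp (measurable_blk_bell b) measurable_snd).
Qed.

Lemma blk_d1_bound (b : @block R) y : 0 < blk_rho b ->
  `|blk_d1 b y| <= (blk_rho b)^-1.
Proof.
move=> r0; rewrite /blk_d1 normrM -[leRHS]mulr1.
by rewrite ler_pM// ?blk_tent_bound// blk_bell_bound.
Qed.

Lemma integrable_blk_d1 (F : set (T * T)) (b : @block R) :
  measurable F -> (lam2 F < +oo)%E -> 0 < blk_rho b ->
  lam2.-integrable F (fun y => (blk_d1 b y)%:E).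
Proof.
move=> mF finF r0; apply: measurable_bounded_integrable => //.
  by apply: measurable_funTS; exact: measurable_blk_d1.
exists (blk_rho b)^-1; split; first exact: num_real.
by move=> x xr y _; apply: le_trans (ltW xr); exact: blk_d1_bound.
Qed.

Variables (D F : set (T * T)) (V : R).
Hypotheses (mF : measurable F) (finF : (lam2 F < +oo)%E).
Hypothesis varV : variation1_le D F V.

(** Every height in [K] carries a block that sees at least [c0] times its
    radius of variation.  A compact [K] is covered by finitely many of the
    corresponding intervals, and Vitali's covering lemma extracts disjoint ones
    whose threefold dilations still cover.  Disjointness makes the sum of the
    blocks a single test field, so the sum of the radii is at most [V / c0]; the
    dilated interval of radius [3 r] has length [6 r]. *)
Lemma compact_variation_bound (K : set R) (c0 : R) : compact K -> 0 < c0 ->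
  (forall t, K t -> exists b, [/\ blk_t b = t, admissible D b &
    ((c0 * blk_r b)%:E <= \int[lam2]_(y in F) (blk_d1 b y)%:E)%E]) ->
  (lam K <= (6 / c0 * V)%:E)%E.
Proof.
move=> cK c0_gt0 H.
(* Outside [K] the chosen block is a dummy of positive radius. *)
pose bl t := if pselect (K t) is left h then projT1 (cid (H t h)) else Block t 1 0 0 1.
have blP t : K t -> [/\ blk_t (bl t) = t, admissible D (bl t) &
    ((c0 * blk_r (bl t))%:E <= \int[lam2]_(y in F) (blk_d1 (bl t) y)%:E)%E].
  by move=> Kt; rewrite /bl; case: pselect => // h; case: cid.
have blt t : blk_t (bl t) = t by rewrite /bl; case: pselect => //= h; case: cid => b [].
have blr t : 0 < blk_r (bl t).
  by rewrite /bl; case: pselect => //= h; case: cid => b /= [] _ [].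
have blrho t : 0 < blk_rho (bl t).
  by rewrite /bl; case: pselect => //= h; case: cid => b /= [] _ [].
pose B (t : R) : set R := ball t (blk_r (bl t)).
have [] : finite_subset_cover K B K.
  move: cK; rewrite compact_cover; apply.
    by move=> t _; exact: ball_open.
  by move=> t Kt; exists t => //; exact: ballxx.
move=> S SK KS.
have isB t : is_ball (B t) by exact: is_ball_ball.
have B0 t : B t !=set0 by exists t; exact: ballxx.
have [s [us sS trs cov]] := vitali_lemma_finite_cover isB B0 (finmap.enum_fset S).
have sK i : i \in s -> K i by move=> /sS /SK /set_mem.
have := varV us (fun i si => let: And3 _ h _ := blP i (sK i si) in h).
have -> : (fun i => ball (blk_t (bl i)) (blk_r (bl i))) = B.
  by apply/funext => i; rewrite blt.
move=> /(_ trs) hV.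
have {hV} hV : (\sum_(i <- s) (c0 * blk_r (bl i))%:E <= V%:E)%E.
  apply: le_trans hV; under eq_integral do rewrite -sumEFin.
  rewrite integral_sum//; last by move=> i; exact: integrable_blk_d1.
  rewrite big_seq [leRHS]big_seq; apply: lee_sum => i si.
  by have [_ _] := blP i (sK i si).
have KB : K `<=` \big[setU/set0]_(i <- s) (ball i (3 * blk_r (bl i))).
  apply: (subset_trans KS); apply: (subset_trans cov).
  by move=> x [i si] /=; rewrite scale_ballE// -bigcup_seq => xi; exists i.
apply: (@le_trans _ _ (lam (\big[setU/set0]_(i <- s) (ball i (3 * blk_r (bl i)))))).
  apply: le_measure => //; rewrite inE.
  - exact: compact_measurable.
  - by apply: bigsetU_measurable => i _; exact: measurable_ball.
apply: (@le_trans _ _ (\sum_(i <- s) (6 * blk_r (bl i))%:E)%E).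
  elim: s {us sS trs cov sK hV KB} => [|i s ih].
    by rewrite !big_nil measure0.
  rewrite !big_cons; apply: (le_trans (measureU2 _ _ _)).
  - exact: measurable_ball.
  - by apply: bigsetU_measurable => j _; exact: measurable_ball.
  apply: leeD => //.
  rewrite [leLHS]lebesgue_measure_ball; last by rewrite mulr_ge0// ltW.
  by rewrite lee_fin -mulr_natr; lra.
move: hV; rewrite !sumEFin !lee_fin -!mulr_sumr => hV.
rewrite -mulrA ler_wpM2l//.
by rewrite mulrC ler_pdivlMr// mulrC.
Qed.

End covering.

(** * Lines on which the slice is not constant *)

Section density.
Context {R : realType}.
Local Notation T := (measurableTypeR R).
Local Notation lam := (@lebesgue_measure R).

(** Lebesgue's density theorem, with the missing proportion written as a bound
    linear in the radius. *)
Lemma density_point (A : set T) : measurable A -> lam A != 0%E ->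
  exists2 x, A x & forall e : R, 0 < e ->
    \forall r \near 0^'+, (lam (ball x r `\` A) <= (e * r)%:E)%E.
Proof.
move=> mA A0.
have [Z [mZ Z0 hZ]] := lebesgue_density mA.
have [x [Ax Zx]] : exists x, A x /\ ~ Z x.
  apply: contrapT => h; move/eqP: A0; apply.
  apply/eqP; rewrite -measure_le0 -Z0; apply: le_measure; rewrite ?inE// => x Ax.
  by apply: contrapT => nZ; apply: h; exists x.
exists x => // e e0.
have cv : (lam (A `&` ball x r) * (lam (ball x r))^-1)%E @[r --> 0^'+] --> (1 : \bar R)%E.
  have : ~ ~ ((lam (A `&` ball x r) * (lam (ball x r))^-1)%E @[r --> 0^'+] --> (\1_A x)%:E).
    by move=> h; apply: Zx; apply: hZ.
  by move=> /contrapT; rewrite indicE mem_set.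
move/fine_cvgP : cv => [fin /cvgrPdist_le cv].
have e2 : 0 < e / 2 by rewrite divr_gt0.
have {}cv := cv _ e2.
near=> r.
have r0 : 0 < r by near: r; exact: nbhs_right_gt.
have fr : (lam (A `&` ball x r) * (lam (ball x r))^-1)%E \is a fin_num by near: r.
have : `|1 - fine (lam (A `&` ball x r) * (lam (ball x r))^-1)%E| <= e / 2.
  by near: r; exact: cv.
move=> /(le_trans (ler_norm _)).
have lball : lam (ball x r) = (r *+ 2)%:E by rewrite lebesgue_measure_ball// ltW.
have r2 : 0 < r *+ 2 by rewrite mulrn_wgt0.
have mAB : measurable (A `&` ball x r) by apply: measurableI => //; exact: measurable_ball.
have fA : lam (A `&` ball x r) \is a fin_num.
  rewrite ge0_fin_numE//; apply: (@le_lt_trans _ _ (lam (ball x r))).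
    by apply: le_measure; rewrite ?inE//; exact: measurable_ball.
  by rewrite lball ltry.
rewrite lball inver gt_eqF// -(fineK fA) -EFinM /= => h.
have -> : ball x r `\` A = ball x r `\` (A `&` ball x r).
  by rewrite setDIr setDv setU0.
rewrite measureD//; last 2 first.
- exact: measurable_ball.
- by change (lam (ball x r) < +oo)%E; rewrite lball ltry.
rewrite (setIidr (@subIsetr _ A _)).
change (lam (ball x r) - lam (A `&` ball x r) <= (e * r)%:E)%E.
rewrite lball -(fineK fA) -EFinB lee_fin.
move: h; set a := fine _ => h.
have : (1 - a / (r *+ 2)) * (r *+ 2) <= e / 2 * (r *+ 2).
  by rewrite ler_wpM2r// ltW.
rewrite mulrBl mul1r divfK ?gt_eqF// => /le_trans; apply.
by rewrite -mulr_natr; lra.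
Unshelve. all: by end_near. Qed.

End density.

Section jump_set.
Context {R : realType}.
Local Notation T := (measurableTypeR R).
Local Notation lam := (@lebesgue_measure R).
Local Notation lam2 := (@borel_lebesgue2 R).

(** Inside the unit square, moving right or up does not leave the domain.
    This is how a Lipschitz domain looks in a suitable frame, and it makes the
    rectangle of a block lie in the domain as soon as its left edge does. *)
Definition up_set (D : set (R * R)) := forall s t s' t' : R, D (s, t) ->
  s <= s' -> t <= t' -> s' < 1 -> t' < 1 -> D (s', t').

Variables (D F : set (T * T)) (V : R).
Hypotheses (D_open : open (D : set (R * R))) (D_sub : D `<=` unit_square)
  (D_up : up_set D).
Hypotheses (mF : measurable F) (F_sub : F `<=` D).

Let F_sq : F `<=` unit_square. Proof. exact: subset_trans F_sub D_sub. Qed.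

(** Suppose that the slice [A] of [F] nearly fills the ball around [x] while a
    disjoint set [G] nearly fills the ball around [x'].  The tent around [q] is
    at least 1/2 on an interval of length [rho], so its average over [A] is at
    least 1/2 minus half of 1/6; the tent around [q'] has an average over [A] of
    at most 1/6.  The difference is at least 1/2 - 1/12 - 1/6 = 1/4. *)
Lemma slice_int_jump (t q q' x x' rho : R) (G : set T) : 0 < rho ->
  measurable G -> G `&` ysection F t = set0 ->
  `|q - x| < rho -> `|q' - x'| < rho ->
  (lam (ball x (2 * rho) `\` ysection F t) <= (12^-1 * (2 * rho))%:E)%E ->
  (lam (ball x' (2 * rho) `\` G) <= (12^-1 * (2 * rho))%:E)%E ->
  4^-1 <= slice_int F (blk_tent (Block 0 1 q q' rho)) t.
Proof.
move=> r0 mG GF qx qx' h1 h2.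
set b := Block _ _ _ _ _.
have mA : measurable (ysection F t) by exact: measurable_ysection.
set A : set T := ysection F t in GF h1 mA *.
rewrite -lee_fin (slice_intE mF F_sq (measurable_blk_tent b)
  (fun s => @blk_tent_bound _ b s r0)).
set E1 := ball x (2 * rho) `\` A in h1; set E2 := ball x' (2 * rho) `\` G in h2.
have mE1 : measurable E1 by apply: measurableD => //; exact: measurable_ball.
have mE2 : measurable E2 by apply: measurableD => //; exact: measurable_ball.
have mB : measurable (ball q (rho / 2) : set T) by exact: measurable_ball.
have lB : lam (ball q (rho / 2)) = rho%:E.
  rewrite lebesgue_measure_ball; last by rewrite ltW// divr_gt0.
  by congr _%:E; rewrite -mulr_natr; field.
have i1 : lam.-integrable setT (fun s => (rho^-1 / 2 * \1_E1 s)%:E).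
  by apply: integrable_cindic => //; exact: le_lt_trans h1 (ltry _).
have i2 : lam.-integrable setT (fun s => (rho^-1 * \1_E2 s)%:E).
  by apply: integrable_cindic => //; exact: le_lt_trans h2 (ltry _).
have i12 : lam.-integrable setT (fun s => (rho^-1 / 2 * \1_E1 s + rho^-1 * \1_E2 s)%:E).
  exact: (integrableD measurableT i1 i2).
have iB : lam.-integrable setT (fun s => (rho^-1 / 2 * \1_(ball q (rho / 2) : set T) s)%:E).
  by apply: integrable_cindic => //; change (lam (ball q (rho / 2)) < +oo)%E; rewrite lB ltry.
have ri : 0 < rho^-1 by rewrite invr_gt0.
apply: (@le_trans _ _ (\int[lam]_s ((rho^-1 / 2 * \1_(ball q (rho / 2) : set T) s)%:E -
    (rho^-1 / 2 * \1_E1 s + rho^-1 * \1_E2 s)%:E)%E)%E).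
  rewrite integralB_EFin// (integralD_EFin measurableT i1 i2).
  have c1 : 0 <= rho^-1 / 2 by rewrite ltW// divr_gt0.
  rewrite (integral_cindic mB c1) (integral_cindic mE1 c1).
  rewrite (integral_cindic mE2 (ltW ri)) lB leeBrDr; last first.
    rewrite fin_numD !fin_numM// ge0_fin_numE//.
      exact: le_lt_trans h2 (ltry _).
    exact: le_lt_trans h1 (ltry _).
  apply: (@le_trans _ _ (4^-1%:E + ((rho^-1 / 2)%:E * (12^-1 * (2 * rho))%:E +
      rho^-1%:E * (12^-1 * (2 * rho))%:E))%E).
    apply: leeD2l; apply: leeD; apply: lee_wpmul2l => //; rewrite lee_fin; lra.
  rewrite -!EFinM -!EFinD lee_fin le_eqVlt; apply/orP; left; apply/eqP.
  by field; rewrite gt_eqF.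
apply: le_integral => //.
- exact: (integrableB measurableT iB i12).
- by apply: (slice_integrable mF F_sq (measurable_blk_tent b)
    (fun s => @blk_tent_bound _ b s r0)).
move=> s _; rewrite -EFinB lee_fin /blk_tent /= mulrA [leRHS]mulrC.
have -> : rho^-1 / 2 * \1_(ball q (rho / 2) : set T) s -
   (rho^-1 / 2 * \1_E1 s + rho^-1 * \1_E2 s) = rho^-1 *
   (2^-1 * \1_(ball q (rho / 2) : set T) s - 2^-1 * \1_E1 s - \1_E2 s) by ring.
apply: ler_wpM2l; first exact: ltW.
have -> : \1_F (s, t) = \1_A s :> R.
  rewrite !indicE; congr (_%:R); congr nat_of_bool.
  by apply/idP/idP; rewrite !inE /A /ysection/= inE.
set a := tent _; set a' := tent _.
have a0 : 0 <= a := tent_ge0 _; have a'0 : 0 <= a' := tent_ge0 _.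
have a'1 : a' <= 1 := tent_le1 _.
have nB z z' (d d' : R) : `|z - z'| < d -> ball z d' s -> d + d' <= 2 * rho -> ball z' (2 * rho) s.
  rewrite /ball/= => h3 h4 h5; apply: lt_le_trans h5.
  by rewrite -[z' - s](subrKA z) (le_lt_trans (ler_normD _ _))// ltrD// distrC.
have hE2 : a' = 0 \/ ~ A s \/ E2 s.
  have [As|] := pselect (A s); last by right; left.
  have [qs|qs] := ltP `|q' - s| rho.
    right; right; split; first by apply: (nB _ _ _ _ qx' qs); lra.
    by move=> Gs; rewrite -[False]/(set0 s) -GF.
  left; apply: tent_out; rewrite normrM normfV (gtr0_norm r0) ler_pdivlMr// mul1r.
  by rewrite distrC.
have hB : ball q (rho / 2) s -> (A s /\ 2^-1 <= a) \/ (~ A s /\ E1 s).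
  move=> qs; have [As|nAs] := pselect (A s); [left|right]; split => //.
    apply: tent_in; rewrite normrM normfV (gtr0_norm r0) ler_pdivrMr//.
    by move: qs; rewrite /ball/= distrC mulrC => /ltW.
  by split => //; apply: (nB _ _ _ _ qx qs); lra.
have e1 : 0 <= \1_E1 s :> R by [].
have e2 : 0 <= \1_E2 s :> R by [].
have e1' : E1 s -> \1_E1 s = 1 :> R by move=> h; rewrite indicE mem_set.
have e2' : E2 s -> \1_E2 s = 1 :> R by move=> h; rewrite indicE mem_set.
have [As|nAs] := pselect (A s).
- have -> : \1_A s = 1 :> R by rewrite indicE mem_set.
  have : - \1_E2 s <= - a' :> R.
    by rewrite lerN2; case: hE2 => [->//|[//|/e2' ->]].
  have : 2^-1 * \1_(ball q (rho / 2) : set T) s <= a.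
    rewrite indicE; have [/set_mem /hB [[_ ?]|[//]]|_] := boolP (s \in _).
      by rewrite mulr1.
    by rewrite mulr0.
  lra.
- have -> : \1_A s = 0 :> R by rewrite indicE memNset.
  have : 2^-1 * \1_(ball q (rho / 2) : set T) s <= 2^-1 * \1_E1 s :> R.
    have [/[dup] qs /hB [[//]|[_ /e1' ->]]|nqs] := pselect (ball q (rho / 2) s).
      by rewrite indicE mem_set.
    have -> : \1_(ball q (rho / 2) : set T) s = 0 :> R by rewrite indicE memNset.
    by rewrite mulr0 mulr_ge0.
  lra.
Qed.

Hypothesis varV : variation1_le D F V.

Lemma open_vertical_section (a : R) : open [set t | D (a, t)].
Proof.
apply: (@open_comp _ _ (fun t : R => (a, t))) => // t _.
exact: (cvg_pair (cvg_cst a) cvg_id).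
Qed.

Lemma open_horizontal_section (t : R) : open [set a | D (a, t)].
Proof.
apply: (@open_comp _ _ (fun a : R => (a, t))) => // a _.
exact: (cvg_pair cvg_id (cvg_cst t)).
Qed.

(** Only the profile in the first coordinate matters for detecting a jump, so
    the height and the radius of this block are arbitrary.  Rational centres and
    the widths [1 / (n + 1)] make the family countable. *)
Definition jump_block (k : nat * rat * rat) : @block R :=
  Block 0 1 (ratr k.1.2) (ratr k.2) k.1.1.+1%:R^-1.

(** The heights at which [jump_block k] sees a jump and its horizontal extent
    lies in [D]. *)
Definition jump_at (k : nat * rat * rat) : set T := [set t |
  [/\ D (ratr k.1.2 - k.1.1.+1%:R^-1, t), D (ratr k.2 - k.1.1.+1%:R^-1, t),
      (ratr k.1.2 + k.1.1.+1%:R^-1 < 1 :> R) && (ratr k.2 + k.1.1.+1%:R^-1 < 1 :> R) &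
      4^-1 <= slice_int F (blk_tent (jump_block k)) t]].

Definition nth_jump (i : nat) : nat * rat * rat :=
  odflt (0%N, 0, 0) (unpickle i).

Definition jump_set : set T := \bigcup_i jump_at (nth_jump i).

Let bnd k s : `|blk_tent (jump_block k) s| <= (blk_rho (jump_block k))^-1.
Proof. by apply: blk_tent_bound; rewrite invr_gt0 ltr0n. Qed.

Lemma measurable_jump_at k : measurable (jump_at k).
Proof.
have -> : jump_at k = [set t | D (ratr k.1.2 - k.1.1.+1%:R^-1, t)] `&`
    [set t | D (ratr k.2 - k.1.1.+1%:R^-1, t)] `&`
    [set t | (ratr k.1.2 + k.1.1.+1%:R^-1 < 1 :> R) && (ratr k.2 + k.1.1.+1%:R^-1 < 1 :> R)] `&`
    (slice_int F (blk_tent (jump_block k)) @^-1` `[4^-1, +oo[).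
  apply/seteqP; split => t /=; rewrite in_itv/= andbT.
    by move=> [? ? ? ?].
  by move=> [[[? ?] ?] ?]; split.
apply: measurableI; first apply: measurableI; first apply: measurableI.
- by apply: open_measurable; exact: open_vertical_section.
- by apply: open_measurable; exact: open_vertical_section.
- by case: andP => [h|h]; [rewrite (_ : mkset _ = setT)//|rewrite (_ : mkset _ = set0)//];
    apply/seteqP; split.
- rewrite -[X in measurable X]setTI.
  by apply: (measurable_slice_int mF F_sq (measurable_blk_tent _) (bnd k)).
Qed.

Lemma measurable_jump_set : measurable jump_set.
Proof. by apply: bigcupT_measurable => i; exact: measurable_jump_at. Qed.

(** At a Lebesgue point of the slice integral, a jump at one height persists
    on average over nearby heights, so that the block multiplied by a thin bump
    still captures variation.  As [D] is open, a thin enough bump keeps the box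
    inside [D]. *)
Lemma jump_block_variation k t : jump_at k t ->
  lebesgue_pt (slice_int F (blk_tent (jump_block k))) t ->
  exists b, [/\ blk_t b = t, admissible D b &
    ((16^-1 * blk_r b)%:E <= \int[lam2]_(y in F) (blk_d1 b y)%:E)%E].
Proof.
move=> [D1 D2 /andP[q1 q2] hk] lp.
set rho := k.1.1.+1%:R^-1 in D1 D2 q1 q2.
have rho0 : 0 < rho by rewrite invr_gt0 ltr0n.
have i := integrable_slice_int mF F_sq (measurable_blk_tent _) (bnd k).
have p4 : 0 < 4^-1 :> R by [].
have lpb := lebesgue_pt_bell i lp p4 hk.
have o1 := @open_vertical_section (ratr k.1.2 - rho).
have o2 := @open_vertical_section (ratr k.2 - rho).
have n1 : \forall r \near 0^'+, forall t', t - r <= t' <= t + r -> D (ratr k.1.2 - rho, t').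
  have /nbhs_ballP[d /= d0 hd] : nbhs t [set t | D (ratr k.1.2 - rho, t)] by exact: open_nbhs_nbhs.
  near=> r => t' /andP[h1 h2]; apply: hd; rewrite /ball/= ltr_norml.
  have : r < d by near: r; exact: nbhs_right_lt.
  by move=> ?; apply/andP; split; lra.
have n2 : \forall r \near 0^'+, forall t', t - r <= t' <= t + r -> D (ratr k.2 - rho, t').
  have /nbhs_ballP[d /= d0 hd] : nbhs t [set t | D (ratr k.2 - rho, t)] by exact: open_nbhs_nbhs.
  near=> r => t' /andP[h1 h2]; apply: hd; rewrite /ball/= ltr_norml.
  have : r < d by near: r; exact: nbhs_right_lt.
  by move=> ?; apply/andP; split; lra.
have np : \forall r \near (0:R)^'+, 0 < r by exact: nbhs_right_gt.
have [r [[r0 hr] [h1 h2]]] := @filter_ex _ _ (at_right_proper_filter (0:R)) _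
  (filterI (filterI np lpb) (filterI n1 n2)).
exists (Block t r (ratr k.1.2) (ratr k.2) rho); split => //=.
- split => //= -[s t'] [/= a1 a2 a3 a4].
  have t't : t - r <= t' <= t + r by rewrite a3.
  have {}h1 := h1 _ t't; have {}h2 := h2 _ t't.
  have [_ /= ] := D_sub h1; rewrite in_itv/= => /andP[_ t'1].
  have s1 : s < 1 by apply: le_lt_trans a2 _; rewrite maxEle; case: ifP.
  move: a1; rewrite minEle; case: ifP => _ a1.
    exact: (D_up h1 a1 (lexx _) s1 t'1).
  exact: (D_up h2 a1 (lexx _) s1 t'1).
- rewrite /blk_d1.
  rewrite (integral_slice_int mF F_sq (measurable_blk_tent (jump_block k)) (bnd k)
    (measurable_blk_bell (Block t r (ratr k.1.2) (ratr k.2) rho)) (blk_bell_bound _)).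
  apply: le_trans hr; rewrite lee_fin; lra.
Unshelve. all: by end_near. Qed.

(** Almost every height is a Lebesgue point of each of the countably many
    slice integrals; on a compact set of such heights the covering bound applies
    with constant 1/16, and inner regularity passes to the whole jump set. *)
Lemma jump_set_le : (lam jump_set <= (96 * V)%:E)%E.
Proof.
have [Z [mZ Z0 hZ]] : lam.-negligible (\bigcup_i
    ~` [set t | lebesgue_pt (slice_int F (blk_tent (jump_block (nth_jump i)))) t]).
  apply: negligible_bigcup => i.
  apply: lebesgue_differentiation; apply: open_integrable_locally; first exact: openT.
  exact: (integrable_slice_int mF F_sq (measurable_blk_tent _) (bnd _)).
have mJ := measurable_jump_set.
apply: (@le_trans _ _ (lam (jump_set `\` Z) + lam Z)%E).
  apply: (@le_trans _ _ (lam ((jump_set `\` Z) `|` Z))).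
    apply: le_measure; rewrite ?inE//; first by apply: measurableU => //; exact: measurableD.
    by move=> t Jt; have [Zt|nZt] := pselect (Z t); [right|left].
  by apply: measureU2 => //; exact: measurableD.
rewrite Z0 adde0 lebesgue_regularity_inner_sup; last exact: measurableD.
apply: ge_ereal_sup => _ [K [cK KJ] <-].
have fF : (lam2 F < +oo)%E by exact: lam2_fin mF F_sq.
have -> : 96 = 6 / 16^-1 :> R by field.
apply: (compact_variation_bound mF fF varV cK) => // t Kt.
have [[i _ Ji] nZ] := KJ _ Kt.
apply: (jump_block_variation Ji); apply: contrapT => h.
by apply: nZ; apply: hZ; exists i.
Qed.

(** If both the slice and its complement in the slice of [D] had positive
    measure, each would have a density point, and rational centres near these
    two points with a small width would exhibit a jump. *)
Lemma slice_constant t : ~ jump_set t ->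
  lam (ysection F t) = 0%E \/ lam (ysection D t `\` ysection F t) = 0%E.
Proof.
move=> nJ; have [->|/eqP F0] := pselect (lam (ysection F t) = 0%E); first by left.
have [->|/eqP G0] := pselect (lam (ysection D t `\` ysection F t) = 0%E); first by right.
exfalso; apply: nJ.
have secE (A : set (T * T)) s : ysection A t s = A (s, t).
  by rewrite /ysection/= propeqE inE.
have mA : measurable (ysection F t) by exact: measurable_ysection.
have mD : measurable (ysection D t).
  have -> : ysection D t = [set a | D (a, t)] by apply/funext => s; rewrite secE.
  by apply: open_measurable; exact: open_horizontal_section.
have mG : measurable (ysection D t `\` ysection F t) by exact: measurableD.
have [x Ax hx] := density_point mA F0.
have [x' Gx' hx'] := density_point mG G0.
have p12 : 0 < 12^-1 :> R by [].
have {}hx := hx _ p12; have {}hx' := hx' _ p12.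
have Dx : D (x, t) by apply: F_sub; rewrite -secE.
have Dx' : D (x', t) by rewrite -secE; case: Gx'.
have nD z : D (z, t) -> \forall r \near (0:R)^'+, D (z - r, t) /\ z + r < 1.
  move=> Dz; have /nbhs_ballP[d /= d0 hd] : nbhs z [set a | D (a, t)].
    by apply: open_nbhs_nbhs; split => //; exact: open_horizontal_section.
  have [/= + _] := D_sub Dz; rewrite in_itv/= => /andP[_ z1].
  near=> r; split.
    apply: hd; rewrite /ball/= opprB addrC subrK ger0_norm; last by near: r; exact: nbhs_right_ge.
    by near: r; exact: nbhs_right_lt.
  have : r < 1 - z by near: r; apply: nbhs_right_lt; lra.
  by lra.
have [d d0 hd] : exists2 d : R, 0 < d & forall r, 0 < r < d ->
  [/\ (lam (ball x r `\` ysection F t) <= (12^-1 * r)%:E)%E,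
      (lam (ball x' r `\` (ysection D t `\` ysection F t)) <= (12^-1 * r)%:E)%E,
      D (x - r, t) /\ x + r < 1 & D (x' - r, t) /\ x' + r < 1].
  have [d /= d0 hd] := filterI (filterI hx hx') (filterI (nD _ Dx) (nD _ Dx')).
  exists d => // r /andP[r0 rd].
  have := hd r; rewrite /ball_/= sub0r normrN gtr0_norm// => /(_ rd r0).
  by move=> [[? ?] [? ?]].
pose n := Num.trunc (2 / d).
have rho0 : 0 < n.+1%:R^-1 :> R by rewrite invr_gt0 ltr0n.
have rhod : 2 * n.+1%:R^-1 < d.
  rewrite ltr_pdivrMr// mulrC -ltr_pdivrMr//.
  exact: truncnS_gt.
set rho : R := n.+1%:R^-1 in rho0 rhod.
have [h1 h2 [h3 h3'] [h4 h4']] : _ := hd (2 * rho) ltac:(by apply/andP; split => //; lra).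
have [q /andP[q1 q2]] : exists q : rat, x - rho < ratr q < x + rho.
  have [|q] := @rat_in_itvoo R (x - rho) (x + rho); first by lra.
  by rewrite in_itv/= => ?; exists q.
have [q' /andP[q1' q2']] : exists q : rat, x' - rho < ratr q < x' + rho.
  have [|q'] := @rat_in_itvoo R (x' - rho) (x' + rho); first by lra.
  by rewrite in_itv/= => ?; exists q'.
have t1 : t < 1 by have [_ /=] := D_sub Dx; rewrite in_itv/= => /andP[].
have x1 : x < 1 by have [/= + _] := D_sub Dx; rewrite in_itv/= => /andP[].
have x'1 : x' < 1 by have [/= + _] := D_sub Dx'; rewrite in_itv/= => /andP[].
exists (pickle (n, q, q')) => //.
have -> : nth_jump (pickle (n, q, q')) = (n, q, q') by rewrite /nth_jump pickleK.
split => /=; rewrite -/rho.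
- by apply: (D_up h3) => //; lra.
- by apply: (D_up h4) => //; lra.
- by apply/andP; split; lra.
- apply: (slice_int_jump rho0 mG _ _ _ h1 h2).
  + by apply/seteqP; split => s // [[]].
  + by rewrite ltr_norml; apply/andP; split; lra.
  + by rewrite ltr_norml; apply/andP; split; lra.
Unshelve. all: by end_near. Qed.

End jump_set.

(** * Crossing horizontal and vertical lines *)

Section crossing.
Context {R : realType}.
Local Notation T := (measurableTypeR R).
Local Notation lam := (@lebesgue_measure R).
Local Notation lam2 := (@borel_lebesgue2 R).
Local Notation half := (`](2^-1 : R), 1[%classic : set T).
Implicit Types (F G : set (T * T)) (N A : set T).

Lemma xsectionE F s : xsection F s = [set t | F (s, t)].
Proof. by apply/seteqP; split=> t; rewrite /xsection/= inE. Qed.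

Lemma ysectionE F t : ysection F t = [set s | F (s, t)].
Proof. by apply/seteqP; split=> s; rewrite /ysection/= inE. Qed.

Lemma lam2_null F : measurable F ->
  {ae lam, forall s, lam (xsection F s) = 0%E} -> lam2 F = 0%E.
Proof.
move=> mF h; rewrite lam2_xsection.
rewrite (ae_eq_integral (cst 0%E))//.
- by rewrite integral0.
- exact: measurable_fun_xsection.
- by apply: filterS h => s hs _.
Qed.

Lemma null_lam2 F : measurable F -> lam2 F = 0%E ->
  {ae lam, forall s, lam (xsection F s) = 0%E}.
Proof.
move=> mF; rewrite lam2_xsection => h.
have mf : measurable_fun setT (fun s => lam (xsection F s)) by exact: measurable_fun_xsection.
have : ae_eq lam setT (fun s => lam (xsection F s)) (cst 0%E).
  apply/(ae_eq_integral_abs lam measurableT mf).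
  by under eq_integral do rewrite gee0_abs//.
by apply: filterS => s /(_ I).
Qed.

Definition transpose F : set (T * T) := [set y | F (y.2, y.1)].

Lemma measurable_transpose F : measurable F -> measurable (transpose F).
Proof.
move=> mF; have [_ ms _] := @scales_measure_swap R.
by have := ms measurableT _ mF; rewrite setTI.
Qed.

Lemma lam2_transpose F : measurable F -> lam2 (transpose F) = lam2 F.
Proof. by move=> mF; have [_ _ ->//] := @scales_measure_swap R; rewrite mul1e. Qed.

Lemma xsection_transpose F s : xsection (transpose F) s = ysection F s.
Proof. by rewrite xsectionE ysectionE. Qed.

Lemma ysection_transpose F s : ysection (transpose F) s = xsection F s.
Proof. by rewrite xsectionE ysectionE. Qed.

(** A vertical line on which [G] is null meets the set [A] of heights, up to
    measure zero, in points of [F]; but almost no vertical line meets [F] in a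
    non-null set of heights in [A].  So once [A] has positive measure, almost
    every vertical line outside [N] has to be null for [F] rather than for
    [G]. *)
Lemma null_lines_spread F G A N : measurable F -> measurable G -> measurable A ->
  (0 < lam A)%E -> (forall t, A t -> lam (ysection F t) = 0%E) ->
  (forall s, ~ N s -> lam (xsection F s) = 0%E \/ lam (xsection G s) = 0%E) ->
  (forall s t, 0 < s < 1 -> A t -> (F `|` G) (s, t)) ->
  F `<=` unit_square ->
  {ae lam, forall s, ~ N s -> lam (xsection F s) = 0%E}.
Proof.
move=> mF mG mA A0 FA FG hA Fsq.
have mFA : measurable (F `&` (setT `*` A)).
  by apply: measurableI => //; exact: measurableX.
have : lam2 (F `&` (setT `*` A)) = 0%E.
  rewrite lam2_ysection// integral0_eq// => t _.
  have [At|nAt] := pselect (A t).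
    apply/eqP; rewrite -measure_le0 -(FA t At); apply: le_measure; rewrite ?inE.
    - exact: measurable_ysection.
    - exact: measurable_ysection.
    - by rewrite !ysectionE => s [].
  by rewrite (_ : ysection _ _ = set0) ?measure0// ysectionE; apply/seteqP; split => s // [_ []].
move=> /(null_lam2 mFA); apply: filterS => s h0 nNs.
have [s01|ns01] := boolP (0 < s < 1); last first.
  rewrite (_ : xsection F s = set0) ?measure0// xsectionE.
  apply/seteqP; split => t // /Fsq [] /=; rewrite in_itv/= => h _.
  by rewrite h in ns01.
have [//|hG] := FG s nNs; exfalso.
suff : (lam A <= 0)%E by rewrite leNgt A0.
apply: (@le_trans _ _ (lam (xsection (F `&` (setT `*` A)) s `|` xsection G s))).
  apply: le_measure; rewrite ?inE//.
    by apply: measurableU; exact: measurable_xsection.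
  move=> t At; rewrite !xsectionE.
  by have [Ft|Gt] := hA s t s01 At; [left|right].
apply: (le_trans (measureU2 _ _ _)); try exact: measurable_xsection.
by rewrite /= h0 hG adde0.
Qed.

(** Up to null sets, [F] lies over the exceptional positions [N2] and at the
    exceptional heights [N1], hence in the rectangle [N2 `*` N1].  The product
    of two one-dimensional measures is what turns a linear bound in the
    perimeter into a quadratic one. *)
Lemma lam2_le_rect F N1 N2 : measurable F -> measurable N1 -> measurable N2 ->
  {ae lam, forall s, ~ N2 s -> lam (xsection F s) = 0%E} ->
  {ae lam, forall t, ~ N1 t -> lam (ysection F t) = 0%E} ->
  (lam2 F <= lam N2 * lam N1)%E.
Proof.
move=> mF mN1 mN2 h2 h1.
have null X N : measurable X -> measurable N ->
    {ae lam, forall s, ~ N s -> lam (xsection X s) = 0%E} ->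
    lam2 (X `&` (~` N `*` setT)) = 0%E.
  move=> mX mN h.
  apply: lam2_null.
    by apply: measurableI => //; apply: measurableX => //; exact: measurableC.
  apply: filterS h => s h; have [Ns|nNs] := pselect (N s).
    rewrite (_ : xsection _ _ = set0) ?measure0// xsectionE.
    by apply/seteqP; split => t // [_ []].
  apply/eqP; rewrite -measure_le0 -(h nNs); apply: le_measure; rewrite ?inE.
  - apply: measurable_xsection; apply: measurableI => //.
    by apply: measurableX => //; exact: measurableC.
  - exact: measurable_xsection.
  - by rewrite !xsectionE => t [].
have z2 := null _ _ mF mN2 h2.
have z1 : lam2 (transpose F `&` (~` N1 `*` setT)) = 0%E.
  apply: null => //; first exact: measurable_transpose.
have mZ2 : measurable (F `&` (~` N2 `*` setT)).
  by apply: measurableI => //; apply: measurableX => //; exact: measurableC.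
have mZ1 : measurable (transpose F `&` (~` N1 `*` setT)).
  apply: measurableI => //; first exact: measurable_transpose.
  by apply: measurableX => //; exact: measurableC.
have {}z1 : lam2 (transpose (transpose F `&` (~` N1 `*` setT))) = 0%E.
  by rewrite lam2_transpose.
have {}mZ1 := measurable_transpose mZ1.
have mR : measurable (N2 `*` N1) by exact: measurableX.
apply: (@le_trans _ _ (lam2 ((N2 `*` N1) `|` ((F `&` (~` N2 `*` setT)) `|`
    transpose (transpose F `&` (~` N1 `*` setT)))))).
  apply: le_measure; rewrite ?inE//; first by do 2 apply: measurableU => //.
  move=> [s t] Fst; have [N1t|nN1t] := pselect (N1 t); last by right; right.
  by have [N2s|nN2s] := pselect (N2 s); [left|right; left].
apply: (le_trans (measureU2 _ _ _)) => //; first exact: measurableU.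
rewrite [X in (X + _)%E]product_measure1E//.
rewrite -[leRHS]adde0; apply: leeD => //.
apply: (le_trans (measureU2 _ _ _)) => //.
by rewrite /= z1 z2 adde0.
Qed.

(** Beyond the middle of the unit square, horizontal and vertical lines run
    entirely inside the domain, so they all cross one another there. *)
Definition halves_in (D : set (T * T)) := forall s t : R, 0 < s < 1 -> 0 < t < 1 ->
  (2^-1 < s) || (2^-1 < t) -> D (s, t).

Lemma lam_half_setD N : measurable N -> (lam N < (2^-1)%:E)%E ->
  (0 < lam (half `\` N))%E.
Proof.
move=> mN N2; rewrite lt0e measure_ge0 andbT; apply/eqP => h.
have : (lam half <= lam N)%E.
  apply: (@le_trans _ _ (lam ((half `\` N) `|` N))).
    apply: le_measure; rewrite ?inE//.
      by apply: measurableU => //; exact: measurableD.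
    by move=> x hx; have [?|?] := pselect (N x); [right|left].
  apply: (le_trans (measureU2 _ _ _)) => //; first exact: measurableD.
  by rewrite [X in (X + _)%E]h add0e.
rewrite lebesgue_measure_itv/= lte_fin ifT; last lra.
move=> /le_lt_trans /(_ N2); rewrite -EFinB lte_fin; lra.
Qed.

(** One set of positive measure of heights beyond 1/2 on which [F] is null
    spreads to almost all unexceptional vertical lines, and these, taken beyond
    1/2, spread in turn to almost all unexceptional horizontal lines. *)
Lemma crossing_aux F G N1 N2 :
  measurable F -> measurable G -> measurable N1 -> measurable N2 ->
  F `<=` unit_square -> halves_in (F `|` G) ->
  (forall t, ~ N1 t -> lam (ysection F t) = 0%E \/ lam (ysection G t) = 0%E) ->
  (forall s, ~ N2 s -> lam (xsection F s) = 0%E \/ lam (xsection G s) = 0%E) ->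
  (lam N2 < (2^-1)%:E)%E ->
  (0 < lam (half `&` [set t | lam (ysection F t) = 0%E]))%E ->
  (lam2 F <= lam N2 * lam N1)%E.
Proof.
move=> mF mG mN1 mN2 Fsq hF h1 h2 N2h A0.
have mnull (X : set (T * T)) : measurable X -> measurable [set t | lam (xsection X t) = 0%E].
  move=> mX; rewrite -[X in measurable X]setTI.
  have : measurable_fun setT (fun s => lam (xsection X s)) by exact: measurable_fun_xsection.
  by move=> /(_ measurableT [set 0%E]); apply; exact: emeasurable_set1.
have mnull' (X : set (T * T)) : measurable X -> measurable [set t | lam (ysection X t) = 0%E].
  move=> mX; have := mnull _ (measurable_transpose mX).
  by under eq_set do rewrite xsection_transpose.
have v : {ae lam, forall s, ~ N2 s -> lam (xsection F s) = 0%E}.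
  apply: (null_lines_spread (G := G) (A := half `&` [set t | lam (ysection F t) = 0%E])) => //.
  - by apply: measurableI => //; exact: mnull'.
  - by move=> t [].
  - move=> s t s01 [/=]; rewrite in_itv/= => /andP[t2 t1] _; apply: hF => //.
      by rewrite t1 andbT; lra.
    by rewrite t2 orbT.
apply: lam2_le_rect => //.
have [Z [mZ Z0 hZ]] := v.
have mA : measurable (half `&` [set s | lam (xsection F s) = 0%E]).
  by apply: measurableI => //; exact: mnull.
have : {ae lam, forall t, ~ N1 t -> lam (xsection (transpose F) t) = 0%E}.
  apply: (null_lines_spread (G := transpose G) (A := half `&` [set s | lam (xsection F s) = 0%E])) => //.
  - exact: measurable_transpose.
  - exact: measurable_transpose.
  - apply: lt_le_trans (lam_half_setD (measurableU _ _ mN2 mZ) _) _.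
      apply: le_lt_trans (measureU2 _ mN2 mZ) _.
      by rewrite [X in (_ + X)%E]Z0 adde0.
    apply: le_measure; rewrite ?inE//.
      by apply: measurableD => //; exact: measurableU.
    move=> s [s2 nNZ]; split => //=; apply: contrapT => nz.
    apply: (nNZ); right; apply: hZ => /= hh; apply: nz; apply: hh => Ns.
    by apply: nNZ; left.
  - by move=> s [_ /=]; rewrite ysection_transpose.
  - move=> t s t01 [/=]; rewrite in_itv/= => /andP[s2 s1] _.
    have : (F `|` G) (s, t).
      by apply: hF => //; [rewrite s1 andbT; lra|rewrite s2].
    by move=> [?|?]; [left|right].
  - by move=> [t s] /Fsq [].
by apply: filterS => t; rewrite xsection_transpose.
Qed.

(** As [N1] does not exhaust the heights beyond 1/2, either [F] or [G] is null
    on a set of such heights of positive measure. *)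
Lemma crossing F G N1 N2 :
  measurable F -> measurable G -> measurable N1 -> measurable N2 ->
  F `|` G `<=` unit_square -> halves_in (F `|` G) ->
  (forall t, ~ N1 t -> lam (ysection F t) = 0%E \/ lam (ysection G t) = 0%E) ->
  (forall s, ~ N2 s -> lam (xsection F s) = 0%E \/ lam (xsection G s) = 0%E) ->
  (lam N1 < (2^-1)%:E)%E -> (lam N2 < (2^-1)%:E)%E ->
  (lam2 F <= lam N2 * lam N1)%E \/ (lam2 G <= lam N2 * lam N1)%E.
Proof.
move=> mF mG mN1 mN2 sq hFG h1 h2 N1h N2h.
have Fsq : F `<=` unit_square by move=> y Fy; apply: sq; left.
have Gsq : G `<=` unit_square by move=> y Gy; apply: sq; right.
have mnull X : measurable X -> measurable (half `&` [set t | lam (ysection X t) = 0%E]).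
  move=> mX; apply: measurableI => //; rewrite -[X in measurable X]setTI.
  have : measurable_fun setT (fun s => lam (ysection X s)) by exact: measurable_fun_ysection.
  by move=> /(_ measurableT [set 0%E]); apply; exact: emeasurable_set1.
have := lam_half_setD mN1 N1h.
have [F0|/negP] := boolP (0 < lam (half `&` [set t | lam (ysection F t) = 0%E]))%E.
  by left; exact: (crossing_aux (G := G)).
move=> /negP; rewrite -leNgt => F0 pos; right.
apply: (crossing_aux (G := F)) => //.
- by rewrite setUC.
- by move=> t /h1 []; [right|left].
- by move=> s /h2 []; [right|left].
rewrite ltNge; apply/negP => G0; move: pos; rewrite ltNge => /negP; apply.
apply: (@le_trans _ _ (lam ((half `&` [set t | lam (ysection F t) = 0%E]) `|`
    (half `&` [set t | lam (ysection G t) = 0%E])))).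
  apply: le_measure; rewrite ?inE.
  - exact: measurableD.
  - by apply: measurableU; exact: mnull.
  - by move=> t [th /h1 []]; [left|right].
apply: (le_trans (measureU2 _ _ _)); try exact: mnull.
by rewrite -[leRHS]adde0; apply: leeD.
Qed.

End crossing.

(** * Charts adapted to a Lipschitz domain *)

Section good_charts.
Context {R : realType}.
Implicit Types (Omega : set (R * R)) (p q u v w x y : R * R).

Definition chart_domain Omega p v w : set (R * R) :=
  [set y | @unit_square R y /\ Omega (frame p v w y)].

Definition good_chart Omega p v w := [/\ det2 v w != 0,
  up_set (chart_domain Omega p v w) & halves_in (chart_domain Omega p v w)].

Lemma frame_swap p v w s t : frame p w v (s, t) = frame p v w (t, s).
Proof. by rewrite /frame/= addrAC. Qed.

Lemma chart_domain_swap Omega p v w :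
  chart_domain Omega p w v = transpose (chart_domain Omega p v w).
Proof.
apply/seteqP; split=> -[s t] [[/= s01 t01]]; rewrite frame_swap => h; by split.
Qed.

Lemma good_chart_swap Omega p v w : good_chart Omega p v w -> good_chart Omega p w v.
Proof.
move=> [d0 up hl]; split.
- by rewrite /det2 -oppr_eq0 opprB mulrC [X in _ - X]mulrC.
- rewrite chart_domain_swap => s t s' t' h ss tt s1 t1.
  exact: (up _ _ _ _ h tt ss t1 s1).
- rewrite chart_domain_swap => s t s01 t01 h; apply: hl => //.
  by rewrite orbC.
Qed.

Lemma unit_squareP (s t : R) :
  unit_square (s, t) <-> [/\ 0 < s, s < 1, 0 < t & t < 1].
Proof.
rewrite /unit_square /=; split.
  by move=> [] /=; rewrite !in_itv/= => /andP[? ?] /andP[? ?].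
by move=> [? ? ? ?]; split; rewrite /= in_itv/=; apply/andP.
Qed.

Lemma interior_chart Omega q : open Omega -> Omega q ->
  exists p v w, good_chart Omega p v w /\
    exists2 y, unit_square y & frame p v w y = q.
Proof.
move=> oO Oq; have /nbhs_ballP[e /= e0 he] : nbhs q Omega by exact: open_nbhs_nbhs.
exists (q - (e / 2, e / 2)), (e, 0), (0, e).
have fE s t : frame (q - (e / 2, e / 2)) (e, 0) (0, e) (s, t) =
    (q.1 + e * (s - 2^-1), q.2 + e * (t - 2^-1)).
  by rewrite /frame; congr pair; rewrite /= /GRing.scale/=; field.
have cd s t : unit_square (s, t) -> chart_domain Omega (q - (e / 2, e / 2)) (e, 0) (0, e) (s, t).
  move=> sq; split => //; apply: he; move/unit_squareP : sq => [s0 s1 t0 t1].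
  rewrite fE; split; rewrite /ball/= opprD addNKr normrN normrM gtr0_norm// gtr_pMr// ltr_norml;
    apply/andP; split; lra.
split; first split.
- by rewrite /det2/= mul0r subr0 mulf_neq0// gt_eqF.
- move=> s t s' t' [/unit_squareP [s0 s1 t0 t1] _] ss tt s'1 t'1.
  by apply: cd; apply/unit_squareP; split => //; lra.
- by move=> s t /andP[? ?] /andP[? ?] _; apply: cd; apply/unit_squareP.
exists (2^-1, 2^-1); first by apply/unit_squareP; split; lra.
by rewrite fE subrr !mulr0 !addr0; case: q {Oq he fE cd}.
Qed.

Lemma enorm_lt x (r : R) : 0 < r -> dot x x < r ^+ 2 -> enorm x < r.
Proof.
move=> r0 h; rewrite /enorm -[ltRHS](gtr0_norm r0) -sqrtr_sqr ltr_sqrt//.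
exact: exprn_gt0.
Qed.

Lemma closure_enorm Omega q (e : R) : closure Omega q -> 0 < e ->
  exists2 x, Omega x & enorm (x - q) < e.
Proof.
move=> cq e0; have e2 : 0 < e / 2 by rewrite divr_gt0.
have [x [Ox [/= h1 h2]]] := cq _ (nbhsx_ballx q (e / 2) e2).
exists x => //; apply: enorm_lt => //.
have sq (a b : R) : `|b - a| < e / 2 -> (a - b) ^+ 2 < (e / 2) ^+ 2.
  by move=> h; rewrite -[ltLHS]real_normK ?num_real// distrC ltr_pXn2r ?nnegrE// ltW.
have := sq _ _ h1; have := sq _ _ h2; rewrite /dot/= -!expr2.
have -> : e ^+ 2 = 4 * (e / 2) ^+ 2 by field.
have := sqr_ge0 (e / 2); lra.
Qed.

(** The frame vectors lie in the cone around the inner direction [u'] that the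
    Lipschitz constant allows: with [M = 2 * L + 2], the point with coordinates
    [(s, t)] has tangential displacement [e * (s - t)] and normal displacement
    [e * M * (s + t - 1/4)] from [q].  Raising [s] or [t] lifts the point faster
    than the graph can rise, and if [s] or [t] exceeds 1/2 the point is already
    above the graph, because [q] is not below it.  The origin is placed so that
    [q] has coordinates [(1/8, 1/8)], well inside the unit square. *)
Lemma boundary_chart Omega q : closure Omega q -> ~ Omega q -> open Omega ->
  lipschitz_boundary Omega ->
  exists p v w, good_chart Omega p v w /\
    exists2 y, unit_square y & frame p v w y = q.
Proof.
move=> cq nq oO lip.
have [r [u [g [r0 u1 gl Og]]]] : exists (r : R) (u : R * R) (g : R -> R),
    [/\ 0 < r, enorm u = 1, lipschitz g &
     forall x, enorm (x - q) < r ->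
       Omega x <-> g (dot x u) < dot x (- u.2, u.1)].
  by apply: lip; split => // /interior_subset.
have [L [L0 gL]] : exists L : R, 0 <= L /\ forall a b, `|g a - g b| <= L * `|a - b|.
  have np : \forall M \near +oo, (0 : R) <= M by exact: nbhs_pinfty_ge.
  rewrite /lipschitz_on in gl; have [L [hL L0]] := filter_ex (filterI gl np).
  by exists L; split => // a b; exact: (hL (a, b)).
have uu : u.1 ^+ 2 + u.2 ^+ 2 = 1 by have := enorm_sqr u; rewrite u1 /dot expr1n !expr2.
pose u' : R * R := (- u.2, u.1).
have u'1 : enorm u' = 1.
  by rewrite -u1 /enorm /dot/=; congr Num.sqrt; rewrite mulrNN addrC.
have dotB x e (z : R * R) : dot (x - e) z = dot x z - dot e z.
  by rewrite /dot/=; ring.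
have dotN x (z : R * R) : dot (- x) z = - dot x z by rewrite /dot/=; ring.
have dot_abs x (z : R * R) : enorm z = 1 -> `|dot x z| <= enorm x.
  move=> z1; rewrite ler_norml; apply/andP; split.
    rewrite lerNl -dotN (le_trans (dot_le _ _))// z1 mulr1.
    by rewrite -scaleN1r enormZ normrN1 mul1r.
  by rewrite (le_trans (dot_le _ _))// z1 mulr1.
(* A limit of points above the graph is not below it. *)
have gq : g (dot q u) <= dot q u'.
  rewrite leNgt; apply/negP => h.
  pose d := g (dot q u) - dot q u'.
  have d0 : 0 < d by rewrite subr_gt0.
  have L1 : 0 < 1 + L by rewrite ltr_pwDl.
  pose e := Num.min r (d / (1 + L)).
  have e0 : 0 < e by rewrite lt_min r0 divr_gt0.
  have [x Ox xq] := closure_enorm cq e0.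
  have xr : enorm (x - q) < r by apply: lt_le_trans xq _; rewrite ge_min lexx.
  have xd : enorm (x - q) * (1 + L) < d.
    rewrite -ltr_pdivlMr//; apply: lt_le_trans xq _; by rewrite ge_min lexx orbT.
  have := (Og _ xr).1 Ox; rewrite -/u' => gx.
  have a1 := dot_abs (x - q) _ u1; have a2 := dot_abs (x - q) _ u'1.
  rewrite dotB in a1; rewrite dotB in a2.
  have a3 := gL (dot q u) (dot x u).
  have a4 : L * `|dot q u - dot x u| <= L * enorm (x - q).
    by rewrite ler_wpM2l// distrC.
  have a5 := ler_norm (g (dot q u) - g (dot x u)).
  have a6 := ler_norm (dot x u' - dot q u').
  rewrite mulrDr mulr1 in xd; rewrite /d in xd; lra.
pose M := 2 * L + 2.
have M0 : 0 < M by rewrite /M; lra.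
pose e := r / (2 * (1 + 2 * M)).
have e0 : 0 < e by rewrite divr_gt0// mulr_gt0//; lra.
pose v : R * R := e *: (u + M *: u').
pose w : R * R := e *: (- u + M *: u').
pose p := q - 8^-1 *: (v + w).
have fq s t : frame p v w (s, t) - q = e *: ((s - t) *: u + (M * (s + t - 4^-1)) *: u').
  by rewrite /frame /p /v /w; congr pair; rewrite /= /GRing.scale/=; field.
have near s t : unit_square (s, t) -> enorm (frame p v w (s, t) - q) < r.
  move/unit_squareP => [s0 s1 t0 t1]; rewrite fq; apply: enorm_lt => //.
  have -> : dot (e *: ((s - t) *: u + (M * (s + t - 4^-1)) *: u'))
      (e *: ((s - t) *: u + (M * (s + t - 4^-1)) *: u')) =
      e ^+ 2 * ((s - t) ^+ 2 + M ^+ 2 * (s + t - 4^-1) ^+ 2).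
    transitivity (e ^+ 2 * ((s - t) ^+ 2 + M ^+ 2 * (s + t - 4^-1) ^+ 2) *
      (u.1 ^+ 2 + u.2 ^+ 2)); last by rewrite uu mulr1.
    by rewrite /dot /u' /= /GRing.scale/=; ring.
  have rE : r = e * (2 * (1 + 2 * M)).
    by rewrite /e divfK// gt_eqF// mulr_gt0//; lra.
  have -> : r ^+ 2 = e ^+ 2 * (2 * (1 + 2 * M)) ^+ 2 by rewrite {1}rE; ring.
  rewrite ltr_pM2l ?exprn_gt0//.
  have b1 : (s - t) ^+ 2 <= 1 by nra.
  have b2 : (s + t - 4^-1) ^+ 2 <= 4 by nra.
  have b3 : M ^+ 2 * (s + t - 4^-1) ^+ 2 <= M ^+ 2 * 4.
    by apply: ler_wpM2l => //; exact: sqr_ge0.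
  have b4 : 0 <= M ^+ 2 by exact: sqr_ge0.
  have -> : (2 * (1 + 2 * M)) ^+ 2 = 4 + 16 * M + 16 * M ^+ 2 by ring.
  lra.
have fu s t : dot (frame p v w (s, t)) u = dot q u + e * (s - t).
  apply/eqP; rewrite addrC -subr_eq -dotB fq; apply/eqP.
  transitivity (e * (s - t) * (u.1 ^+ 2 + u.2 ^+ 2)); last by rewrite uu mulr1.
  by rewrite /dot /u' /= /GRing.scale/=; ring.
have fu' s t : dot (frame p v w (s, t)) u' = dot q u' + e * M * (s + t - 4^-1).
  apply/eqP; rewrite addrC -subr_eq -dotB fq; apply/eqP.
  transitivity (e * M * (s + t - 4^-1) * (u.1 ^+ 2 + u.2 ^+ 2)); last by rewrite uu mulr1.
  by rewrite /dot /u' /= /GRing.scale/=; ring.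
have cdP s t : unit_square (s, t) -> (chart_domain Omega p v w (s, t) <->
    g (dot q u + e * (s - t)) < dot q u' + e * M * (s + t - 4^-1)).
  move=> sq; have := Og _ (near s t sq); rewrite -/u' fu fu' => h.
  by split => [[_ /h]//|/h]; split.
exists p, v, w; split; first split.
- have -> : det2 v w = 2 * M * e ^+ 2 * (u.1 ^+ 2 + u.2 ^+ 2).
    by rewrite /det2 /v /w /u' /= /GRing.scale/=; ring.
  by rewrite uu mulr1 gt_eqF// mulr_gt0 ?exprn_gt0//; lra.
- move=> s t s' t' cd ss tt s'1 t'1.
  have [/unit_squareP [s0 s1 t0 t1] _] := cd.
  have sq : unit_square (s, t) by apply/unit_squareP.
  have sq' : unit_square (s', t') by apply/unit_squareP; split => //; lra.
  have c := (cdP _ _ sq).1 cd; apply/(cdP _ _ sq').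
  have a1 := ler_norm (g (dot q u + e * (s' - t')) - g (dot q u + e * (s - t))).
  have a2 := gL (dot q u + e * (s' - t')) (dot q u + e * (s - t)).
  have a3 : `|dot q u + e * (s' - t') - (dot q u + e * (s - t))| <= e * ((s' - s) + (t' - t)).
    have -> : dot q u + e * (s' - t') - (dot q u + e * (s - t)) = e * ((s' - s) - (t' - t)) by ring.
    rewrite normrM gtr0_norm// ler_wpM2l ?(ltW e0)// ler_norml; apply/andP; split; lra.
  have a4 : L * `|dot q u + e * (s' - t') - (dot q u + e * (s - t))| <=
      M * (e * ((s' - s) + (t' - t))).
    apply: ler_pM => //; rewrite /M; lra.
  have -> : e * M * (s' + t' - 4^-1) = e * M * (s + t - 4^-1) + M * (e * ((s' - s) + (t' - t))) by ring.
  lra.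
- move=> s t /andP[s0 s1] /andP[t0 t1] half.
  have sq : unit_square (s, t) by apply/unit_squareP.
  apply/(cdP _ _ sq).
  have a1 := ler_norm (g (dot q u + e * (s - t)) - g (dot q u)).
  have a2 := gL (dot q u + e * (s - t)) (dot q u).
  have a3 : `|dot q u + e * (s - t) - dot q u| = e * `|s - t|.
    by rewrite addrAC subrr add0r normrM gtr0_norm.
  have a4 : L * `|s - t| < M * (s + t - 4^-1).
    have [st|st] := ger0P (s - t).
      have : 2^-1 < s by case/orP : half => //; lra.
      by move=> hs; rewrite /M; nra.
    have : 2^-1 < t by case/orP : half => //; lra.
    by move=> hs; rewrite /M; nra.
  have a5 : e * (L * `|s - t|) < e * (M * (s + t - 4^-1)) by rewrite ltr_pM2l.
  rewrite a3 mulrCA in a2; rewrite mulrA in a5; rewrite -mulrA.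
  rewrite mulrA in a5 *.
  lra.
exists (8^-1, 8^-1); first by apply/unit_squareP; split; lra.
apply/eqP; rewrite -subr_eq0 fq subrr scale0r add0r.
have -> : 8^-1 + 8^-1 - 4^-1 = 0 :> R by field.
by rewrite mulr0 scale0r scaler0.
Qed.

Lemma exists_chart Omega q : open Omega -> lipschitz_boundary Omega ->
  closure Omega q -> exists p v w, good_chart Omega p v w /\
    exists2 y, unit_square y & frame p v w y = q.
Proof.
move=> oO lip cq; have [Oq|nq] := pselect (Omega q); first exact: interior_chart.
exact: boundary_chart.
Qed.

End good_charts.

(** * Open sets, bounded sets and integrals in the plane *)

Section plane.
Context {R : realType}.
Local Notation T := (measurableTypeR R).
Local Notation lam2 := (@borel_lebesgue2 R).

(** The product sigma-algebra is generated by rectangles, and an open set is a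
    countable union of squares with rational centres. *)
Lemma open_measurable_plane (A : set (R * R)) : open A -> measurable (A : set (T * T)).
Proof.
move=> oA.
pose box (k : nat * rat * rat) : set (T * T) :=
  (ball (ratr k.1.2 : R) (k.1.1.+1%:R^-1) : set T) `*` (ball (ratr k.2 : R) (k.1.1.+1%:R^-1) : set T).
pose nthk (i : nat) : nat * rat * rat := odflt (0%N, 0, 0) (unpickle i).
have -> : A = \bigcup_i (if `[< box (nthk i) `<=` A >] then box (nthk i) else set0).
  apply/seteqP; split => [x Ax|x [i _]]; last by case: asboolP => // h /h.
  have /nbhs_ballP[d /= d0 hd] : nbhs x A by exact: open_nbhs_nbhs.
  pose n := Num.trunc (2 / d).
  have rho0 : 0 < n.+1%:R^-1 :> R by rewrite invr_gt0 ltr0n.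
  have rhod : 2 * n.+1%:R^-1 < d.
    rewrite ltr_pdivrMr// mulrC -ltr_pdivrMr//; exact: truncnS_gt.
  have rat_near (z : R) : exists q : rat, `|ratr q - z| < n.+1%:R^-1.
    set rho := _^-1 in rho0 *.
    have [|q] := @rat_in_itvoo R (z - rho) (z + rho); first by lra.
    rewrite in_itv/= => /andP[? ?]; exists q; rewrite ltr_norml; apply/andP; split; lra.
  have [q1 h1] := rat_near x.1; have [q2 h2] := rat_near x.2.
  exists (pickle (n, q1, q2)) => //.
  have -> : nthk (pickle (n, q1, q2)) = (n, q1, q2) by rewrite /nthk pickleK.
  case: asboolP => [_|[]]; first by split.
  move=> y [/= y1 y2]; apply: hd.
  have tr (a b c : R) : `|a - b| < n.+1%:R^-1 -> `|a - c| < n.+1%:R^-1 -> `|b - c| < d.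
    move=> ab ac; apply: lt_trans rhod; have := ler_normD (b - a) (a - c).
    rewrite subrKA (distrC b a); set rho := _^-1 in rho0 ab ac * => h; lra.
  by split; [exact: tr h1 y1|exact: tr h2 y2].
apply: bigcupT_measurable => i; case: asboolP => // _.
by apply: measurableX; exact: measurable_ball.
Qed.

Lemma bounded_lam2 (A : set (R * R)) : bounded_set A -> measurable (A : set (T * T)) ->
  (lam2 A < +oo)%E.
Proof.
move=> bA mA; have [M hM] : exists M : R, forall x, A x -> `|x| <= M.
  by have [M hM] := filter_ex (bA : \forall M \near +oo, _); exists M.
have mI : measurable (`[- M, M]%classic : set T) by exact: measurable_itv.
apply: (@le_lt_trans _ _ (lam2 ((`[- M, M]%classic : set T) `*` (`[- M, M]%classic : set T)))).
  apply: le_measure; rewrite ?inE//; first exact: measurableX.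
  move=> [x1 x2] /hM; rewrite prod_normE/= ge_max !ler_norml => /andP[h1 h2].
  by split; rewrite /= in_itv.
rewrite [X in (X < _)%E]product_measure1E//= lebesgue_measure_itv/=.
by case: ifP => _; rewrite ?mule0 ?ltry// -EFinB -EFinM ltry.
Qed.

Lemma bounded_closure_compact (A : set (R * R)) : bounded_set A -> compact (closure A).
Proof.
move=> bA; have [M hM] : exists M : R, forall x, A x -> `|x| <= M.
  by have [M hM] := filter_ex (bA : \forall M \near +oo, _); exists M.
apply: (@subclosed_compact _ _ (`[- M, M] `*` `[- M, M])).
- exact: closed_closure.
- by apply: compact_setX; exact: segment_compact.
rewrite closureE; apply: smallest_sub.
  have -> : `[- M, M]%classic `*` `[- M, M]%classic =
    (fst @^-1` `[- M, M]%classic) `&` (snd @^-1` `[- M, M]%classic) :> set (R * R) by [].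
  by apply: closedI; apply: preimage_closed; try exact: interval_closed;
    move=> x _; [exact: cvg_fst|exact: cvg_snd].
move=> [x1 x2] /hM; rewrite prod_normE/= ge_max !ler_norml => /andP[h1 h2].
by split; rewrite /= in_itv.
Qed.

Lemma ge0_integral_scaled (S : T * T -> T * T) (c : R) (A : set (T * T)) (f : T * T -> \bar R) :
  scales_measure S c -> measurable A -> measurable_fun A f -> (forall x, A x -> (0 <= f x)%E) ->
  (\int[lam2]_(y in S @^-1` A) f (S y) = c%:E * \int[lam2]_(x in A) f x)%E.
Proof.
move=> [c0 mS hS] mA mf f0.
have c0' : 0 <= c by exact: ltW.
rewrite -(ge0_integral_mscale _ mA (NngNum c0'))//.
rewrite -[LHS](ge0_integral_pushforward mS lam2 mA mf); last by move=> x /set_mem; exact: f0.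
by apply: eq_measure_integral => B mB _; exact: hS.
Qed.

Lemma integral_scaled (S : T * T -> T * T) (c : R) (A : set (T * T)) (f : T * T -> \bar R) :
  scales_measure S c -> measurable A -> lam2.-integrable A f ->
  (\int[lam2]_(y in S @^-1` A) f (S y) = c%:E * \int[lam2]_(x in A) f x)%E.
Proof.
move=> sS mA fi; have mf := measurable_int _ fi.
rewrite [LHS]integralE [in RHS]integralE.
rewrite [X in (X - _)%E](_ : _ = c%:E * \int[lam2]_(x in A) f^\+ x)%E; last first.
  rewrite -(ge0_integral_scaled sS mA (measurable_funepos mf) (fun x _ => funepos_ge0 f x)).
  by apply: eq_integral => x _; rewrite -[fun _ => f _]/(f \o S) funepos_comp.
rewrite [X in (_ - X)%E](_ : _ = c%:E * \int[lam2]_(x in A) f^\- x)%E; last first.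
  rewrite -(ge0_integral_scaled sS mA (measurable_funeneg mf) (fun x _ => funeneg_ge0 f x)).
  by apply: eq_integral => x _; rewrite -[fun _ => f _]/(f \o S) funeneg_comp.
apply/esym/muleBr => //; apply: fin_num_adde_defr.
exact: (integrable_fin_num mA (integrable_funepos mA fi)).
Qed.

End plane.

(** * The isoperimetric inequality in one chart *)

Section chart_variation.
Context {R : realType}.
Local Notation T := (measurableTypeR R).
Local Notation lam := (@lebesgue_measure R).
Local Notation lam2 := (@borel_lebesgue2 R).
Variables (H : R * R -> R) (alpha : R) (Omega : set (R * R)).
Hypotheses (alpha_gt0 : 0 < alpha) (H_ge : forall x, alpha * enorm x <= H x).
Hypotheses (Omega_open : open Omega) (Omega_bounded : bounded_set Omega).
Implicit Types (p v w : R * R) (E : set (T * T)).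

(** A real bound on the perimeter, with the Borel measure in place of its
    completion. *)
Definition perimeter_le E (P : R) := forall s : R * R -> R * R, C1_0 Omega s ->
  (forall x, polar H (s x) <= 1) ->
  (\int[lam2]_(x in E) (divergence s x)%:E <= P%:E)%E.

Lemma blk_d1_neq0 (b : @block R) y : 0 < blk_r b -> 0 < blk_rho b ->
  blk_d1 b y != 0 -> blk_box b y.
Proof.
move=> r0 rho0; rewrite /blk_d1 mulf_eq0 negb_or => /andP[h1 h2].
have hr : `|y.2 - blk_t b| < blk_r b.
  by rewrite ltNge; apply: contraNN h2 => h; rewrite blk_bell_out.
move: hr; rewrite ltr_norml => /andP[? ?].
have tent0 c : tent ((y.1 - c) / blk_rho b) != 0 -> `|y.1 - c| < blk_rho b.
  move=> h; rewrite ltNge; apply: contraNN h => h; apply/eqP; apply: tent_out.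
  by rewrite normrM normfV (gtr0_norm rho0) ler_pdivlMr// mul1r.
have : tent ((y.1 - blk_c b) / blk_rho b) != 0 \/ tent ((y.1 - blk_c' b) / blk_rho b) != 0.
  apply: contrapT => /not_orP[/negP/negPn/eqP a1 /negP/negPn/eqP a2].
  by move/eqP: h1; apply; rewrite /blk_tent a1 a2 subrr mul0r.
have mn : Num.min (blk_c b) (blk_c' b) <= blk_c b /\ Num.min (blk_c b) (blk_c' b) <= blk_c' b.
  by rewrite !ge_min !lexx orbT.
have mx : blk_c b <= Num.max (blk_c b) (blk_c' b) /\ blk_c' b <= Num.max (blk_c b) (blk_c' b).
  by rewrite !le_max !lexx orbT.
case: mn mx => [? ?] [? ?].
by move=> [] /tent0; rewrite ltr_norml => /andP[? ?]; split; lra.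
Qed.

Lemma compact_supp (s : R * R -> R * R) : supp s `<=` Omega -> compact (supp s).
Proof.
move=> sO; apply: subclosed_compact (bounded_closure_compact Omega_bounded) _.
  exact: closed_closure.
exact: subset_trans sO (@subset_closure _ _).
Qed.

Lemma test_field_C1_0 p v w (k : R) (s : seq R) (b : R -> @block R) : det2 v w != 0 ->
  (forall i, i \in s -> admissible (chart_domain Omega p v w) (b i)) ->
  C1_0 Omega (test_field p v w k s b).
Proof.
move=> d0 adm.
have sO : supp (test_field p v w k s b) `<=` Omega.
  apply: subset_trans (@supp_test_field _ _ p v w k s b _ _) _.
  - by move=> i /adm [].
  - by move=> i /adm [].
  move=> x [i si] /= bx; have [_ _ /(_ _ bx) []] := adm i si.
  by rewrite coordK.
split => //.
- exact: (class_C1_test_fun p k s b d0 v.1).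
- exact: (class_C1_test_fun p k s b d0 v.2).
- exact: compact_supp.
Qed.

(** A test field of size [alpha] is allowed for the perimeter, and its
    divergence in the plane is the derivative of its blocks in the chart; the
    change of variables contributes the constant [c]. *)
Lemma chart_variation p v w : det2 v w != 0 -> exists2 a : R, 0 < a &
  forall E P, measurable E -> E `<=` Omega -> perimeter_le E P ->
  variation1_le (chart_domain Omega p v w) (chart_domain E p v w) (a * P).
Proof.
move=> d0; have [c sc] := scales_measure_frame p d0.
have c0 : 0 < c by case: sc.
have v0 : v != 0.
  by apply: contra d0 => /eqP ->; rewrite /det2/= !mul0r subrr.
have ev := enorm_gt0 v0.
pose k := alpha / enorm v.
have k0 : 0 < k by rewrite divr_gt0.
exists (c / k); first by rewrite divr_gt0.
move=> E P mE EO hP s b us adm triv.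
have lk : forall x, polar H (test_field p v w k s b x) <= 1.
  move=> x; apply: (polar_le1 alpha_gt0 H_ge).
  rewrite /test_field enormZ -ler_pdivlMr//.
  apply: test_fun_le => //; last exact: ltW.
  - by move=> i /adm [].
  - by move=> i /adm [].
have := hP _ (test_field_C1_0 k d0 adm) lk.
under eq_integral do rewrite divergence_test_field//.
set f := fun y => k * \sum_(i <- s) blk_d1 (b i) y.
rewrite -[X in (X <= _)%E]/(\int[lam2]_(x in E) (f (coord p v w x))%:E)%E => hE.
have mOmega : measurable (Omega : set (T * T)) by exact: open_measurable_plane.
have finE : (lam2 E < +oo)%E.
  by apply: le_lt_trans (bounded_lam2 Omega_bounded mOmega); apply: le_measure; rewrite ?inE.
have mcoord : measurable_fun setT (coord p v w : T * T -> T * T).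
  apply: measurable_fun_pair; apply: measurable_funM => //; apply: measurable_funB;
    apply: measurable_funM => //; apply: measurable_funB => //;
    by [exact: measurable_fst|exact: measurable_snd].
have mf : measurable_fun setT (f : T * T -> R).
  by apply: measurable_funM => //; apply: measurable_sum => i; exact: measurable_blk_d1.
have fM : exists M, forall y, `|f y| <= M.
  exists (k * \sum_(i <- s) (blk_rho (b i))^-1) => y.
  rewrite /f normrM gtr0_norm// ler_pM2l//.
  apply: (le_trans (ler_norm_sum _ _ _)).
  rewrite big_seq [leRHS]big_seq; apply: ler_sum => i si.
  by apply: blk_d1_bound; have [] := adm i si.
have fi : lam2.-integrable E (fun x => (f (coord p v w x))%:E).
  apply: measurable_bounded_integrable => //.
    by apply: measurable_funTS; exact: measurableT_comp.
  have [M hM] := fM; exists M; split; first exact: num_real.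
  by move=> x xM y _; apply: le_trans (ltW xM); exact: hM.
have := integral_scaled sc mE fi.
under eq_integral do rewrite frameK//.
move=> hc.
pose D := chart_domain E p v w.
have mD : measurable D.
  apply: measurableI; first exact: measurable_unit_square.
  by have [_ mS _] := sc; have := mS measurableT _ mE; rewrite setTI.
have fD : (\int[lam2]_(y in frame p v w @^-1` E) (f y)%:E =
           \int[lam2]_(y in D) (f y)%:E)%E.
  rewrite integral_mkcond [RHS]integral_mkcond; apply: eq_integral => y _.
  rewrite !patchE; have [Ey|nEy] := boolP (y \in frame p v w @^-1` E); last first.
    by rewrite ifF//; apply/negP => /set_mem [_ h]; move/negP: nEy; apply; exact/mem_set.
  case: ifPn => // nD; congr _%:E; rewrite /f big_seq big1 ?mulr0// => i si.
  apply/eqP/negPn/negP => nz; move/negP: nD; apply; apply/mem_set.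
  have [r0 rho0 bD] := adm i si.
  by split; [have [] := bD _ (blk_d1_neq0 r0 rho0 nz)|exact: set_mem Ey].
have finD : (lam2 D < +oo)%E.
  apply: (@le_lt_trans _ _ (lam2 (@unit_square R))).
    by apply: le_measure; rewrite ?inE//; [exact: measurable_unit_square|move=> y []].
  by rewrite lam2_unit_square ltry.
have gi : lam2.-integrable D (fun y => (\sum_(i <- s) blk_d1 (b i) y)%:E).
  apply: measurable_bounded_integrable => //.
    by apply: measurable_funTS; apply: measurable_sum => i; exact: measurable_blk_d1.
  have [M hM] := fM; exists (M / k); split; first exact: num_real.
  move=> x xM y _; apply: le_trans (ltW xM); rewrite ler_pdivlMr// mulrC.
  by have := hM y; rewrite /f normrM gtr0_norm.
have : (k%:E * \int[lam2]_(y in D) (\sum_(i <- s) blk_d1 (b i) y)%:E <= (c * P)%:E)%E.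
  rewrite -integralZl//.
  have -> : (\int[lam2]_(y in D) (k%:E * (\sum_(i <- s) blk_d1 (b i) y)%:E) =
             \int[lam2]_(y in D) (f y)%:E)%E by [].
  rewrite -fD hc EFinM; apply: lee_wpmul2l => //.
  by rewrite lee_fin ltW.
rewrite -lee_pdivlMl//.
by rewrite -EFinM (_ : c / k * P = k^-1 * (c * P)); [|rewrite mulrA (mulrC c)].
Qed.

(** The image of [chart_domain] under the frame, as a part of [Omega]. *)
Definition chart_image p v w : set (R * R) :=
  [set x | Omega x /\ @unit_square R (coord p v w x)].

Lemma open_unit_square : open (@unit_square R : set (R * R)).
Proof.
have -> : @unit_square R = (fst @^-1` `]0, 1[%classic) `&` (snd @^-1` `]0, 1[%classic) by [].
by apply: openI; apply: open_comp; try exact: interval_open;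
  move=> x _; [exact: cvg_fst|exact: cvg_snd].
Qed.

Lemma open_chart_image p v w : open (chart_image p v w).
Proof.
apply: openI => //; apply: open_comp; last exact: open_unit_square.
move=> x _.
exact: (cvg_pair (@continuous_coord1 R p v w x) (@continuous_coord2 R p v w x)).
Qed.

Lemma continuous_frame p v w : continuous (frame p v w).
Proof.
move=> y; rewrite /frame; apply: cvgD; first apply: cvgD.
- exact: cvg_cst.
- by apply: cvgZr_tmp; exact: cvg_fst.
- by apply: cvgZr_tmp; exact: cvg_snd.
Qed.

Lemma open_chart_domain p v w : open (chart_domain Omega p v w).
Proof.
apply: openI; first exact: open_unit_square.
by apply: open_comp => // y _; exact: continuous_frame.
Qed.

Lemma chart_domain_sub E p v w : chart_domain E p v w `<=` @unit_square R.
Proof. by move=> y []. Qed.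

Lemma measurable_chart_domain E p v w : det2 v w != 0 -> measurable E ->
  measurable (chart_domain E p v w : set (T * T)).
Proof.
move=> d0 mE; apply: measurableI; first exact: measurable_unit_square.
have [c [_ mS _]] := scales_measure_frame p d0.
by have := mS measurableT _ mE; rewrite setTI.
Qed.

(** Both families of coordinate lines have exceptional sets of measure at most
    a multiple of [P].  If this multiple is small, [crossing] gives the
    quadratic bound; if it is not, the bound exceeds the measure of the unit
    square and is trivial. *)
Lemma chart_isoperimetric p v w : good_chart Omega p v w -> exists2 C : R, 0 < C &
  forall E P, measurable E -> E `<=` Omega -> 0 <= P -> perimeter_le E P ->
  (lam2 (E `&` chart_image p v w) <= (C * P ^+ 2)%:E)%E \/
  (lam2 (chart_image p v w `\` E) <= (C * P ^+ 2)%:E)%E.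
Proof.
move=> gc; have [d0 up hl] := gc; have [d0' up' _] := good_chart_swap gc.
have [a1 a1_gt0 var1] := chart_variation p d0.
have [a2 a2_gt0 var2] := chart_variation p d0'.
have [c [c0 mS hS]] := scales_measure_frame p d0.
pose a := a1 + a2.
exists (c^-1 * (192 * a) ^+ 2).
  by rewrite mulr_gt0 ?invr_gt0// exprn_gt0// mulr_gt0// addr_gt0.
move=> E P mE EO P0 hP.
set D := chart_domain Omega p v w in up hl.
pose F := chart_domain E p v w.
have mOmega : measurable (Omega : set (T * T)) by exact: open_measurable_plane.
have mD : measurable (D : set (T * T)) by exact: measurable_chart_domain.
have mF : measurable (F : set (T * T)) by exact: measurable_chart_domain.
have FD : F `<=` D by move=> y [? /EO]; split.
have mG : measurable (D `\` F : set (T * T)) by exact: measurableD.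
have FGD : F `|` (D `\` F) = D by exact: setDUK.
have imD : frame p v w @^-1` (chart_image p v w) = D.
  by apply/seteqP; split => y [h1 h2]; split => //=; rewrite ?frameK//; rewrite /= frameK in h2.
have imF : frame p v w @^-1` (E `&` chart_image p v w) = F.
  apply/seteqP; split => y; first by move=> [Ey [_]]; rewrite /= frameK//; split.
  by move=> [sq Ey]; split => //; split; [exact: EO|rewrite /= frameK//].
have imG : frame p v w @^-1` (chart_image p v w `\` E) = D `\` F.
  rewrite -imD; apply/seteqP; split => y [Uy nEy]; split => //.
    by move=> [_].
  by move=> Ey; apply: (nEy); split => //; have [] : D y by rewrite -imD.
have mU : measurable (chart_image p v w : set (T * T)).
  by apply: open_measurable_plane; exact: open_chart_image.
have scaleE (A B : set (T * T)) : measurable A -> frame p v w @^-1` A = B ->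
    lam2 A = (c^-1%:E * lam2 B)%E.
  by move=> mA <-; rewrite hS// muleA -EFinM mulVf ?gt_eqF// mul1e.
have small (B : set (T * T)) : (lam2 B <= ((192 * a) ^+ 2 * P ^+ 2)%:E)%E ->
    (c^-1%:E * lam2 B <= (c^-1 * (192 * a) ^+ 2 * P ^+ 2)%:E)%E.
  move=> h; rewrite -mulrA EFinM; apply: lee_wpmul2l => //.
  by rewrite lee_fin invr_ge0 ltW.
rewrite (scaleE _ _ _ imF); last exact: measurableI.
rewrite (scaleE _ _ _ imG); last exact: measurableD.
(* [192 * a * P < 1] makes both exceptional sets, of measure at most
   [96 * a * P], smaller than 1/2. *)
have [big|big] := leP 1 (192 * a * P).
  left; apply: small; apply: (@le_trans _ _ 1%E).
    rewrite -(@lam2_unit_square R); apply: le_measure; rewrite ?inE//.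
      exact: measurable_unit_square.
    exact: chart_domain_sub.
  by rewrite lee_fin -exprMn expr_ge1// (le_trans ler01).
have oD : open (D : set (R * R)) by exact: open_chart_domain.
have oD' : open (chart_domain Omega p w v) by exact: open_chart_domain.
have mF' : measurable (chart_domain E p w v : set (T * T)) by exact: measurable_chart_domain.
have FD' : chart_domain E p w v `<=` chart_domain Omega p w v by move=> y [? /EO]; split.
have v1 := var1 _ _ mE EO hP; have v2 := var2 _ _ mE EO hP.
have J1 := jump_set_le oD (@chart_domain_sub _ _ _ _) up mF FD v1.
have J2 := jump_set_le oD' (@chart_domain_sub _ _ _ _) up' mF' FD' v2.
have mJ1 := measurable_jump_set oD (@chart_domain_sub _ _ _ _) mF FD.
have mJ2 := measurable_jump_set oD' (@chart_domain_sub _ _ _ _) mF' FD'.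
have S1 := slice_constant oD (@chart_domain_sub _ _ _ _) up mF FD.
have S2 := slice_constant oD' (@chart_domain_sub _ _ _ _) up' mF' FD'.
set N1 := jump_set D F in J1 mJ1 S1.
set N2 := jump_set (chart_domain Omega p w v) (chart_domain E p w v) in J2 mJ2 S2.
have b1 : 96 * (a1 * P) <= 96 * (a * P).
  by rewrite ler_pM2l// ler_wpM2r// lerDl ltW.
have b2 : 96 * (a2 * P) <= 96 * (a * P).
  by rewrite ler_pM2l// ler_wpM2r// lerDr ltW.
have {}J1 : (lam N1 <= (96 * (a * P))%:E)%E by apply: le_trans J1 _; rewrite lee_fin.
have {}J2 : (lam N2 <= (96 * (a * P))%:E)%E by apply: le_trans J2 _; rewrite lee_fin.
have lt2 : 96 * (a * P) < 2^-1 by lra.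
have : (lam2 F <= lam N2 * lam N1)%E \/ (lam2 (D `\` F) <= lam N2 * lam N1)%E.
  apply: crossing => //.
  - by rewrite FGD; exact: chart_domain_sub.
  - by rewrite FGD.
  - move=> t /S1.
    have -> : ysection D t `\` ysection F t = ysection (D `\` F) t by rewrite !ysectionE.
    by case; [left|right].
  - move=> s /S2; rewrite !(chart_domain_swap _ p v w) !ysection_transpose.
    have -> : xsection D s `\` xsection F s = xsection (D `\` F) s by rewrite !xsectionE.
    by case; [left|right].
  - by apply: le_lt_trans J1 _; rewrite lte_fin.
  - by apply: le_lt_trans J2 _; rewrite lte_fin.
have NN : (lam N2 * lam N1 <= ((192 * a) ^+ 2 * P ^+ 2)%:E)%E.
  apply: (@le_trans _ _ ((96 * (a * P))%:E * (96 * (a * P))%:E)%E); first exact: lee_pmul.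
  have x2 : 192 * a * P = 96 * (a * P) + 96 * (a * P) by lra.
  rewrite -EFinM lee_fin -exprMn x2 sqrrD -expr2 -addrA lerDl.
  by rewrite addr_ge0 ?sqr_ge0// mulrn_wge0// sqr_ge0.
by move=> [h|h]; [left|right]; apply: small; exact: le_trans h NN.
Qed.

End chart_variation.

(** * Gluing the charts *)

Section global.
Context {R : realType}.
Local Notation T := (measurableTypeR R).
Local Notation lam2 := (@borel_lebesgue2 R).

Lemma open_lam2_gt0 (A : set (R * R)) : open A -> A !=set0 -> (0 < lam2 A)%E.
Proof.
move=> oA [x Ax].
have /nbhs_ballP[d /= d0 hd] : nbhs x A by exact: open_nbhs_nbhs.
have mb (z : R) : measurable (ball z d : set T) by exact: measurable_ball.
apply: (@lt_le_trans _ _ (lam2 ((ball x.1 d : set T) `*` (ball x.2 d : set T)))).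
  rewrite [X in (_ < X)%E]product_measure1E//= !lebesgue_measure_ball ?(ltW d0)//.
  by rewrite -EFinM lte_fin mulr_gt0// mulrn_wgt0.
apply: le_measure; rewrite ?inE.
- exact: measurableX.
- exact: open_measurable_plane.
- by move=> y [y1 y2]; apply: hd; split.
Qed.

Lemma seq_pos_lower_bound (I : eqType) (s : seq I) (g : I -> \bar R) :
  exists2 m : R, 0 < m & forall i, i \in s -> (0 < g i)%E -> (m%:E <= g i)%E.
Proof.
elim: s => [|i s [m m0 hm]]; first by exists 1.
have [gi|gi] := pselect (0 < g i)%E; last first.
  by exists m => // j; rewrite inE => /predU1P[-> /gi//|]; exact: hm.
have [r r0 hr] : exists2 r : R, 0 < r & (r%:E <= g i)%E.
  case: (g i) gi => [r|_|//]; first by rewrite lte_fin => r0; exists r.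
  by exists 1 => //; rewrite leey.
exists (Num.min m r); first by rewrite lt_min m0.
move=> j; rewrite inE => /predU1P[->|js] gj.
  by apply: le_trans hr; rewrite lee_fin ge_min lexx orbT.
by apply: le_trans (hm j js gj); rewrite lee_fin ge_min lexx.
Qed.

Variables (H : R * R -> R) (alpha : R) (Omega : set (R * R)).
Hypotheses (alpha_gt0 : 0 < alpha) (H_ge : forall x, alpha * enorm x <= H x).
Hypotheses (Omega_open : open Omega) (Omega_bounded : bounded_set Omega)
  (Omega_connected : connected Omega) (Omega_lipschitz : lipschitz_boundary Omega).

Let mOmega : measurable (Omega : set (T * T)).
Proof. exact: open_measurable_plane. Qed.

(** The closure of [Omega] is compact, and the charts around its points also
    cover the boundary. *)
Lemma finite_chart_cover : exists (s : seq (R * R)) (ch : R * R -> (R * R) * (R * R) * (R * R)),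
  (forall q, q \in s -> good_chart Omega (ch q).1.1 (ch q).1.2 (ch q).2) /\
  Omega `<=` \bigcup_(q in [set` s]) chart_image Omega (ch q).1.1 (ch q).1.2 (ch q).2.
Proof.
have ex q : exists c : (R * R) * (R * R) * (R * R), closure Omega q ->
    good_chart Omega c.1.1 c.1.2 c.2 /\ @unit_square R (coord c.1.1 c.1.2 c.2 q).
  have [cq|ncq] := pselect (closure Omega q); last by exists (0, 0, 0) => /ncq.
  have [p [v [w [gc [y sy fy]]]]] := exists_chart Omega_open Omega_lipschitz cq.
  exists (p, v, w) => _; split => //=.
  by rewrite -fy frameK//; case: gc.
have [ch hch] := choice ex.
pose V q : set (R * R) := [set x | @unit_square R (coord (ch q).1.1 (ch q).1.2 (ch q).2 x)].
have [] : finite_subset_cover (closure Omega) V (closure Omega).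
  have cc : cover_compact (closure Omega).
    pose X : ptopologicalType := HB.pack (R * R)%type
      (Pointed.class (R * R)%type) (Topological.class (R * R)%type).
    have := bounded_closure_compact Omega_bounded.
    by rewrite -(congr1 (fun c => c (closure Omega)) (compact_cover X)).
  apply: cc.
    move=> q _; apply: open_comp; last exact: open_unit_square.
    by move=> x _; exact: (cvg_pair (@continuous_coord1 R _ _ _ x) (@continuous_coord2 R _ _ _ x)).
  by move=> q cq; exists q => //; have [] := hch q cq.
move=> S SO cov; exists (finmap.enum_fset S), ch; split.
  by move=> q qS; have /set_mem cq := SO q qS; have [] := hch q cq.
move=> x Ox; have [q qS Vq] := cov x (subset_closure Ox).
by exists q.
Qed.

(** In each chart one of [E] and its complement is small.  Two overlapping
    charts cannot disagree on which one when [P] is small, since then their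
    overlap, whose measure is bounded below, would be covered by two small sets.
    The charts where [E] is small and those where its complement is small thus
    have disjoint unions, and connectedness of [Omega] leaves only one kind. *)
Lemma global_isoperimetric : exists2 C : R, 0 < C &
  forall E P, measurable (E : set (T * T)) -> E `<=` Omega -> 0 <= P ->
  perimeter_le H Omega E P ->
  (lam2 E <= (C * P ^+ 2)%:E)%E \/ (lam2 (Omega `\` E) <= (C * P ^+ 2)%:E)%E.
Proof.
have [s [ch [gch cov]]] := finite_chart_cover.
pose U q := chart_image Omega (ch q).1.1 (ch q).1.2 (ch q).2.
have oU q : open (U q) by exact: open_chart_image.
have UO q : U q `<=` Omega by move=> x [].
have mU q : measurable (U q : set (T * T)) by exact: open_measurable_plane.
have [c0 c0_gt0 hc0] : exists2 c0 : R, 0 < c0 & forall q, q \in s ->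
    forall E P, measurable (E : set (T * T)) -> E `<=` Omega -> 0 <= P ->
    perimeter_le H Omega E P ->
    (lam2 (E `&` U q) <= (c0 * P ^+ 2)%:E)%E \/ (lam2 (U q `\` E) <= (c0 * P ^+ 2)%:E)%E.
  have : {subset s <= s} by [].
  elim: {1 3}s => [_|q r ih qrs]; first by exists 1.
  have [|c1 c1_gt0 hc1] := ih; first by move=> q' q'r; apply: qrs; rewrite inE q'r orbT.
  have qs : q \in s by apply: qrs; rewrite mem_head.
  have [c2 c2_gt0 hc2] := chart_isoperimetric alpha_gt0 H_ge Omega_open Omega_bounded (gch q qs).
  exists (c1 + c2); first exact: addr_gt0.
  move=> q'; rewrite inE => q'qr E P mE EO P0 hP.
  have P2 : 0 <= P ^+ 2 by exact: sqr_ge0.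
  have le1 : ((c1 * P ^+ 2)%:E <= ((c1 + c2) * P ^+ 2)%:E)%E.
    by rewrite lee_fin ler_wpM2r// lerDl ltW.
  have le2 : ((c2 * P ^+ 2)%:E <= ((c1 + c2) * P ^+ 2)%:E)%E.
    by rewrite lee_fin ler_wpM2r// lerDr ltW.
  case/predU1P : q'qr => [->|q'r].
    by have [h|h] := hc2 E P mE EO P0 hP; [left|right]; apply: le_trans h le2.
  by have [h|h] := hc1 q' q'r E P mE EO P0 hP; [left|right]; apply: le_trans h le1.
have [m m0 hm] := @seq_pos_lower_bound _ (allpairs pair s s)
  (fun qq => lam2 (U qq.1 `&` U qq.2)).
have finO := bounded_lam2 Omega_bounded mOmega.
pose W := fine (lam2 Omega).
have WE : lam2 Omega = W%:E by rewrite fineK// ge0_fin_numE.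
have W0 : 0 <= W by apply: fine_ge0.
pose n : R := (size s)%:R.
have n0 : 0 <= n by [].
have wm0 : 0 <= 2 * W / m by rewrite divr_ge0 ?mulr_ge0// ltW.
exists ((n + 2 * W / m + 1) * c0).
  by rewrite mulr_gt0// ltr_wpDl// addr_ge0.
move=> E P mE EO P0 hP.
pose K := c0 * P ^+ 2.
have K0 : 0 <= K by rewrite mulr_ge0 ?sqr_ge0 ?ltW.
have -> : (n + 2 * W / m + 1) * c0 * P ^+ 2 = n * K + 2 * W / m * K + K.
  by rewrite /K; ring.
have wmK : 0 <= 2 * W / m * K by rewrite mulr_ge0.
have nK : 0 <= n * K by rewrite mulr_ge0.
(* If the chart bound is not small compared with the overlaps, the measure of
   [Omega] itself is at most a multiple of it. *)
have [big|small] := leP m (2 * K).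
  left; apply: (@le_trans _ _ (lam2 Omega)); first by apply: le_measure; rewrite ?inE.
  rewrite WE lee_fin; apply: (@le_trans _ _ (2 * W / m * K)); last lra.
  have -> : 2 * W / m * K = W * ((2 * K) / m) by ring.
  by rewrite ler_peMr// ler_pdivlMr// mul1r.
(* The unions [A] and [B] of the charts where [E], respectively its
   complement, is the small side. *)
pose a q := q \in s /\ (lam2 (E `&` U q) <= K%:E)%E.
pose b q := q \in s /\ (lam2 (U q `\` E) <= K%:E)%E.
pose A := \bigcup_(q in a) U q.
pose B := \bigcup_(q in b) U q.
have oA : open A by apply: bigcup_open.
have oB : open B by apply: bigcup_open.
have AB : Omega `<=` A `|` B.
  move=> x /cov [q /= qs Uq]; have [h|h] := hc0 q qs E P mE EO P0 hP.
    by left; exists q.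
  by right; exists q.
have AO : A `<=` Omega by move=> x [q _ /UO].
have dAB x : A x -> B x -> False.
  move=> [q [qs hq] Uq] [q' [q's hq'] Uq'].
  have : (m%:E <= lam2 (U q `&` U q'))%E.
    apply: (hm (q, q')); first by apply/allpairsP; exists (q, q').
    by apply: open_lam2_gt0; [exact: openI|exists x].
  apply/negP; rewrite -ltNge; apply: (@le_lt_trans _ _ (K%:E + K%:E)%E); last first.
    by rewrite -EFinD lte_fin; lra.
  apply: (@le_trans _ _ (lam2 ((E `&` U q) `|` (U q' `\` E)))).
    apply: le_measure; rewrite ?inE.
    - exact: measurableI.
    - by apply: measurableU; [exact: measurableI|exact: measurableD].
    - by move=> y [Uy U'y]; have [Ey|nEy] := pselect (E y); [left|right].
  apply: (le_trans (measureU2 _ _ _)); [exact: measurableI|exact: measurableD|].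
  exact: leeD.
have sum_le (X : set (T * T)) (f : R * R -> set (T * T)) (c : R * R -> Prop) :
    measurable X -> (forall q, measurable (f q)) ->
    (forall q, c q -> q \in s) -> (forall q, c q -> (lam2 (f q) <= K%:E)%E) ->
    X `<=` \bigcup_(q in c) f q -> (lam2 X <= (n * K + 2 * W / m * K + K)%:E)%E.
  move=> mX mf cs fK Xf; pose r := [seq q <- s | `[< c q >]].
  apply: (@le_trans _ _ (lam2 (\big[setU/set0]_(q <- r) f q))).
    apply: le_measure; rewrite ?inE//; first by apply: bigsetU_measurable.
    move=> x /Xf [q cq fx]; rewrite -bigcup_seq; exists q => //=.
    by rewrite mem_filter cs// andbT; apply/asboolP.
  apply: (@le_trans _ _ ((size r)%:R * K)%:E); last first.
    have : (size r)%:R <= n by rewrite ler_nat size_filter count_size.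
    by move=> h; rewrite lee_fin; have := ler_wpM2r K0 h; lra.
  have : forall q, q \in r -> c q by move=> q; rewrite mem_filter => /andP[/asboolP].
  elim: r => [_|q r ih hr]; first by rewrite big_nil measure0 mul0r.
  rewrite big_cons /= -natr1 mulrDl mul1r addrC EFinD.
  apply: (le_trans (measureU2 _ _ _)) => //; first exact: bigsetU_measurable.
  apply: leeD; first by apply: fK; apply: hr; rewrite mem_head.
  by apply: ih => q' q'r; apply: hr; rewrite inE q'r orbT.
have [[x Ax]|nA] := pselect (A !=set0).
  left.
  have AE : A = Omega.
    apply: Omega_connected; first by exists x.
    - by exists A => //; apply/seteqP; split => [y Ay|y []//]; split => //; exact: AO.
    - exists (~` B); first exact: open_closedC.
      apply/seteqP; split => y; first by move=> Ay; split; [exact: AO|move=> /(dAB y Ay)].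
      by move=> [/AB [//|By] nB].
  apply: (sum_le E (fun q => E `&` U q) a) => //.
  - by move=> q; exact: measurableI.
  - by move=> q [].
  - by move=> q [].
  - by move=> y Ey; have [q aq Uq] : A y by [rewrite AE; exact: EO]; exists q.
right; apply: (sum_le _ (fun q => U q `\` E) b).
- exact: measurableD.
- by move=> q; exact: measurableD.
- by move=> q [].
- by move=> q [].
- move=> y [/AB [Ay|[q bq Uq]] nE]; last by exists q.
  by exfalso; apply: nA; exists y.
Qed.

End global.

(** * From Borel sets to Lebesgue measurable sets *)

Section completion.
Context {R : realType}.
Local Notation T := (measurableTypeR R).
Local Notation lam2 := (@borel_lebesgue2 R).
Local Notation CT := (caratheodory_type (lam2^*)%mu).

Lemma lebesgue2E (A : set (T * T)) : measurable A -> lebesgue2 A = lam2 A.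
Proof. exact: measurable_mu_extE. Qed.

Lemma borel_lebesgue2_measurable (A : set (T * T)) : measurable A -> lebesgue2_measurable A.
Proof. exact: caratheodory_measurable_mu_ext. Qed.

(** The outer measure is an infimum over countable Borel covers; the
    intersection of near-optimal covers is Borel with the same measure as [E],
    and measurability of [E] turns equality of measures into a null
    difference. *)
Lemma borel_envelope (E : set (R * R)) (Omega : set (R * R)) :
  lebesgue2_measurable E -> E `<=` Omega -> measurable (Omega : set (T * T)) ->
  (lam2 Omega < +oo)%E -> exists B : set (T * T),
  [/\ measurable B, E `<=` B, B `<=` Omega & lebesgue2 (B `\` E) = 0%E].
Proof.
move=> mE EO mO finO.
have finE : (lebesgue2 E < +oo)%E.
  by apply: le_lt_trans finO; rewrite -lebesgue2E//; exact: le_outer_measure.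
have E_fin : lebesgue2 E \is a fin_num.
  by rewrite ge0_fin_numE//; exact: outer_measure_ge0.
have inv0 n : 0 < n.+1%:R^-1 :> R by rewrite invr_gt0 ltr0n.
have coverE (e : R) : 0 < e -> exists2 A, measurable_cover E A &
   (\sum_(0 <= k <oo) lam2 (A k) < lebesgue2 E + e%:E)%E.
  move=> e0; have : lebesgue2 E \is a fin_num by [].
  by move/lb_ereal_inf_adherent => /(_ _ e0)[_/= [A EA] <-] ?; exists A.
pose A n := projT1 (cid2 (coverE _ (inv0 n))).
have mA k : measurable_cover E (A k) by rewrite /A; case: cid2.
have mA_E n : (\sum_(0 <= k <oo) lam2 (A n k) < lebesgue2 E + n.+1%:R^-1%:E)%E.
  by rewrite /A; case: cid2.
pose B := \bigcap_n (\bigcup_m (A n m)) `&` Omega.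
have mUA n : measurable (\bigcup_m (A n m) : set (T * T)).
  by apply: bigcupT_measurable => m; have [/(_ m)] := mA n.
have mB : measurable (B : set (T * T)).
  by apply: measurableI => //; apply: bigcapT_measurable.
have EB : E `<=` B.
  by move=> x Ex; split; [move=> n _; have [_] := mA n; exact|exact: EO].
exists B; split => //; first by move=> x [].
have BE : (lebesgue2 B <= lebesgue2 E)%E.
  apply/lee_addgt0Pr => e e0; near \oo => n.
  apply: (@le_trans _ _ (lebesgue2 E + n.+1%:R^-1%:E)%E); last first.
    by rewrite leeD2l// lee_fin ltW//; near: n; exact: near_infty_natSinv_lt (PosNum e0).
  apply: le_trans (ltW (mA_E n)); rewrite lebesgue2E//.
  apply: (@le_trans _ _ (lam2 (\bigcup_m (A n m)))).
    by apply: le_measure; rewrite ?inE// => x [+ _]; exact.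
  by apply: measure_sigma_subadditive => // m; have [/(_ m)] := mA n.
have mBc := borel_lebesgue2_measurable mB.
have : lebesgue2 B = (lebesgue2 (B `&` E) + lebesgue2 (B `&` ~` E))%E by exact: mE.
rewrite (setIidr EB) -setDE => BED.
have D0 : (0 <= lebesgue2 (B `\` E))%E by exact: outer_measure_ge0.
apply/eqP; rewrite eq_le D0 andbT.
by move: BE; rewrite BED -[leRHS]adde0 leeD2lE.
Unshelve. all: by end_near. Qed.

Lemma continuous_measurable_plane (f : R * R -> R) : continuous f ->
  measurable_fun setT (f : T * T -> R).
Proof.
move=> cf; apply: (measurability _ (RGenOpens.measurableE R)) => _ [_ [a [b ->]] <-].
rewrite setTI; apply: open_measurable_plane; apply: open_comp; last exact: interval_open.
by move=> x _; exact: cf.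
Qed.

Lemma continuous_bounded_on (f : R * R -> R) (A : set (R * R)) : continuous f ->
  bounded_set A -> exists M, forall x, A x -> `|f x| <= M.
Proof.
move=> cf bA; have cA := bounded_closure_compact bA.
have : compact (f @` closure A).
  by apply: continuous_compact => //; apply: continuous_subspaceT.
move=> /compact_bounded bf; have [M hM] := filter_ex (bf : \forall M \near +oo, _).
by exists M => x Ax; apply: hM; exists x => //; exact: subset_closure.
Qed.

(** Both changes, of the set by a null set and of the measure by its
    completion, leave the integral of a continuous function unchanged. *)
Lemma integral_lebesgue2 (f : R * R -> R) (E B Omega : set (R * R)) :
  continuous f -> bounded_set Omega -> lebesgue2_measurable E ->
  measurable (B : set (T * T)) -> E `<=` B -> B `<=` Omega ->
  (lam2 B < +oo)%E -> lebesgue2 (B `\` E) = 0%E ->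
  (\int[lebesgue2]_(x in E) (f x)%:E = \int[lam2]_(x in B) (f x)%:E)%E.
Proof.
move=> cf bO mE mB EB BO finB BE0.
have mBc := borel_lebesgue2_measurable mB.
have mid : measurable_fun (setT : set CT) (fun x : CT => x : T * T).
  by move=> _ A mA; rewrite setTI; exact: borel_lebesgue2_measurable.
have mf := continuous_measurable_plane cf.
have mfc : measurable_fun (setT : set CT) (f : CT -> R) by exact: (measurableT_comp mf mid).
have [M hM] := continuous_bounded_on cf bO.
have fi : lebesgue2.-integrable (B : set CT) (fun x => (f x)%:E).
  apply: measurable_bounded_integrable => //.
  - by change (lebesgue2 B < +oo)%E; rewrite lebesgue2E.
  - exact: measurable_funTS.
  exists M; split; first exact: num_real.
  by move=> x xM y By; apply: le_trans (ltW xM); apply: hM; exact: BO.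
have mBE : lebesgue2_measurable (B `\` E) by exact: (@measurableD _ CT).
transitivity (\int[lebesgue2]_(x in (B : set CT)) (f x)%:E)%E.
  rewrite (negligible_integral mBE mBc fi BE0); congr (integral _ _ _).
  by rewrite setDD; apply/esym/setIidr.
have mfE : measurable_fun setT (fun x : T * T => (f x)%:E) by exact/measurable_EFinP.
rewrite -[LHS](integral_pushforward mid mfE (D := B) fi mB).
apply: eq_measure_integral => A mA _.
exact: lebesgue2E.
Qed.

Lemma continuous_divergence (s : R * R -> R * R) (Omega : set (R * R)) :
  C1_0 Omega s -> continuous (divergence s).
Proof.
move=> [[_ c1 _] [_ _ c2] _ _] x; apply: cvgD; [exact: c1|exact: c2].
Qed.

End completion.

(** The zero field, written as an empty sum of blocks, is a competitor. *)
Lemma perimeter_ge0 (R : realType) (H : R * R -> R) (alpha : R) (Omega E : set (R * R)) :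
  0 < alpha -> (forall x, alpha * enorm x <= H x) ->
  bounded_set Omega -> (0 <= perimeter H Omega E)%E.
Proof.
move=> a0 Ha bO.
have d1 : det2 (@e1 R) (@e2 R) != 0 by rewrite /det2/= mul1r mulr0 subr0 oner_eq0.
apply: ereal_sup_ubound; exists (test_field 0 (@e1 R) (@e2 R) 0 [::] (fun _ : R => Block 0 0 0 0 0)).
  split.
    by apply: (test_field_C1_0 bO) => //.
  move=> x; apply: (polar_le1 a0 Ha).
  rewrite /test_field /test_fun big_nil mulr0 scale0r.
  by rewrite /enorm /dot/= mulr0 addr0 sqrtr0 ltW.
rewrite integral0_eq// => x _.
by rewrite divergence_test_field// big_nil mulr0.
Qed.

Theorem theorem3p1 (R : realType) (H : R * R -> R) (alpha beta : R)
    (H_ge0 : forall x, 0 <= H x)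
    (H_C2 : class_C 2 (~` [set 0]) H)
    (H2_convex : strictly_convex (fun x => H x ^+ 2))
    (H_homogeneous : forall (x : R * R) (t : R), H (t *: x) = `|t| * H x)
    (alpha_gt0 : 0 < alpha) (alpha_le_beta : alpha <= beta)
    (H_bounds : forall x, alpha * enorm x <= H x <= beta * enorm x)
    (Omega : set (R * R))
    (Omega_open : open Omega) (Omega_bounded : bounded_set Omega)
    (Omega_connected : connected Omega)
    (Omega_lipschitz : lipschitz_boundary Omega) :
  exists2 C : R, 0 < C &
    forall E : set (R * R), lebesgue2_measurable E -> E `<=` Omega ->
      (C%:E * mine (lebesgue2 E) (lebesgue2 (Omega `\` E))
         <= perimeter H Omega E ^+ 2)%E.
Proof.
have H_ge x : alpha * enorm x <= H x by have /andP[] := H_bounds x.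
have [C C0 hC] := global_isoperimetric alpha_gt0 H_ge Omega_open Omega_bounded
  Omega_connected Omega_lipschitz.
exists C^-1; first by rewrite invr_gt0.
move=> E mE EO.
have p0 := @perimeter_ge0 R H alpha Omega E alpha_gt0 H_ge Omega_bounded.
have [pfin|] := boolP (perimeter H Omega E \is a fin_num); last first.
  rewrite ge0_fin_numE// -leNgt leye_eq => /eqP ->.
  by rewrite expe2 mulyy leey.
set P := fine (perimeter H Omega E).
have PE : perimeter H Omega E = P%:E by rewrite fineK.
have P0 : 0 <= P by rewrite -lee_fin -PE.
have mO : measurable (Omega : set (measurableTypeR R * measurableTypeR R)).
  exact: open_measurable_plane.
have finO := bounded_lam2 Omega_bounded mO.
have [B [mB EB BO BE0]] := borel_envelope mE EO mO finO.
have finB : (@borel_lebesgue2 R B < +oo)%E.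
  by apply: le_lt_trans finO; apply: le_measure; rewrite ?inE.
have hB : perimeter_le H Omega B P.
  move=> s cs ps; rewrite -PE.
  rewrite -(integral_lebesgue2 (continuous_divergence cs) Omega_bounded mE mB EB BO finB BE0).
  by apply: ereal_sup_ubound; exists s.
rewrite PE -EFin_expe lee_pdivrMl// -EFinM.
have EB_le : (lebesgue2 E <= borel_lebesgue2 B)%E.
  by rewrite -lebesgue2E//; exact: le_outer_measure.
have OE_le : (lebesgue2 (Omega `\` E) <= borel_lebesgue2 (Omega `\` B))%E.
  rewrite -lebesgue2E; last exact: measurableD.
  rewrite -[leRHS]adde0 -BE0.
  apply: le_trans (outer_measureU2 _ _ _); apply: le_outer_measure => x [Ox Ex].
  by have [Bx|Bx] := pselect (B x); [right|left].
have [h|h] := hC B P mB BO P0 hB.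
  by apply: (@le_trans _ _ (lebesgue2 E)); [rewrite ge_min lexx|exact: le_trans h].
apply: (@le_trans _ _ (lebesgue2 (Omega `\` E))); last exact: le_trans h.
by rewrite ge_min lexx orbT.
Qed.
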